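(* For any $d$ with $\sqrt{n}\le d\le n-1$, there is a $d$-regular graph $G$ on $n$ vertices with $\mathcal{R}(G)=O(d\cdot\log n)$. Moreover, for any $d$ with $1\le d\le\sqrt{n}$, there is a graph $G$ on $n$ vertices with minimum degree $d$ and maximum degree $d+1$ such that $\mathcal{R}(G)=O(\sqrt{n}\cdot\log^2 n)$.
   Context: Graphs $G=(V,E)$ are finite, undirected, simple and connected, with $n=|V|$ vertices. A random walk on $G$ moves at each step from its current vertex to a neighbor chosen uniformly at random. The cover time $\mathsf{COV}(s)$ is the expected number of steps for the walk started at $s$ to visit all vertices, and $\mathsf{COV}(G)=\max_{s\in V}\mathsf{COV}(s)$. Randomized broadcast algorithm $\mathsf{RBA}$ (push algorithm): at time $0$ only a vertex $s$ knows a rumor; at each time step $t=1,2,\dots$ every vertex that knows the rumor chooses a neighbor uniformly at random and informs it of the rumor. $I_t$ is the set of informed vertices at time $t$ (so $I_0=\{s\}$). The expected broadcast time is $\mathbf{E}[\mathsf{RBA}(G)]:=\max_{s\in V}\mathbf{E}[\min\{t\in\mathbb{N}: I_t=V\}]$, where the expectation is for the process with $I_0=\{s\}$. Finally, $\mathcal{R}(G):=\mathsf{COV}(G)/\mathbf{E}[\mathsf{RBA}(G)]$.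
   Formalization: The first part assumes n·d even, since otherwise no d-regular graph on n vertices exists; the second part assumes d ≥ 2, since for d = 1 the only such connected graph is the path, whose ratio is at least (n−1)/2, not O(√n log² n). *)

(* Defs.v *)
From HB Require Import structures.
From mathcomp Require Import all_boot all_order all_algebra.
From mathcomp Require Import all_classical all_reals all_analysis.

Set Implicit Arguments.
Unset Strict Implicit.
Unset Printing Implicit Defensive.

Import Order.TTheory GRing.Theory Num.Theory.
Local Open Scope ring_scope.

Definition simple_connected_graph (V : finType) (e : rel V) : Prop :=
  [/\ symmetric e, irreflexive e & forall x y, connect e x y].

Definition neighbors (V : finType) (e : rel V) (v : V) : {set V} :=
  [set w | e v w]%SET.

Definition degree (V : finType) (e : rel V) (v : V) : nat := #|neighbors e v|.

Definition regular (V : finType) (e : rel V) (d : nat) : Prop :=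
  forall v, degree e v = d.

Definition min_degree (V : finType) (e : rel V) (d : nat) : Prop :=
  (exists v, degree e v = d) /\ (forall v, d <= degree e v)%N.

Definition max_degree (V : finType) (e : rel V) (d : nat) : Prop :=
  (exists v, degree e v = d) /\ (forall v, degree e v <= d)%N.

(* A chain with transition probabilities [K] started at [x]: [path_prob K x p]
   is the probability that its first [size p] steps lead successively to the
   states listed in [p].  A time is given by a predicate [Q x p] on finite
   histories; it is the least [t] such that [Q] holds of the first [t] steps. *)
Fixpoint path_prob (R : realType) (S : finType) (K : S -> S -> R)
    (x : S) (p : seq S) : R :=
  if p is y :: p' then K x y * path_prob K y p' else 1.

Definition first_time (S : finType) (Q : S -> seq S -> bool)
    (x : S) (p : seq S) : bool :=
  Q x p && [forall k : 'I_(size p), ~~ Q x (take k p)].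

Definition prob_time (R : realType) (S : finType) (K : S -> S -> R)
    (Q : S -> seq S -> bool) (x : S) (t : nat) : R :=
  \sum_(p : t.-tuple S | first_time Q x p) path_prob K x p.

(* The last summand is the contribution of the event that [Q] never occurs
   (it vanishes when that event is null, since [+oo * 0 = 0]). *)
Definition expected_time (R : realType) (S : finType) (K : S -> S -> R)
    (Q : S -> seq S -> bool) (x : S) : \bar R :=
  (\sum_(0 <= t <oo) (t%:R * prob_time K Q x t)%:E
   + +oo * (1 - \sum_(0 <= t <oo) (prob_time K Q x t)%:E))%E.

Definition walk_step (R : realType) (V : finType) (e : rel V) (v w : V) : R :=
  if e v w then (degree e v)%:R^-1 else 0.

Definition visited_all (V : finType) (s : V) (p : seq V) : bool :=
  [forall v, v \in s :: p].

Definition cover_time_from (R : realType) (V : finType) (e : rel V) (s : V) :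
    \bar R :=
  expected_time (@walk_step R V e) (@visited_all V) s.

Definition cover_time (R : realType) (V : finType) (e : rel V) : \bar R :=
  \big[Order.max/-oo%E]_(s : V) cover_time_from R e s.

(* [c] records the independent choices made by the informed vertices. *)
Definition push (V : finType) (I : {set V})
    (c : {ffun {v : V | v \in I} -> V}) : {set V} :=
  (I :|: [set c v | v : {v : V | v \in I}])%SET.

Definition push_step (R : realType) (V : finType) (e : rel V)
    (I J : {set V}) : R :=
  \sum_(c : {ffun {v : V | v \in I} -> V} | push c == J)
    \prod_(v : {v : V | v \in I}) walk_step R e (val v) (c v).

Definition informed_all (V : finType) (I : {set V}) (p : seq {set V}) : bool :=
  last I p == [set: V]%SET.

Definition broadcast_time_from (R : realType) (V : finType) (e : rel V)
    (s : V) : \bar R :=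
  expected_time (@push_step R V e) (@informed_all V) [set s]%SET.

Definition broadcast_time (R : realType) (V : finType) (e : rel V) : \bar R :=
  \big[Order.max/-oo%E]_(s : V) broadcast_time_from R e s.

Definition cover_broadcast_ratio (R : realType) (V : finType) (e : rel V) :
    \bar R :=
  (cover_time R e / broadcast_time R e)%E.

(* Main.v *)
Require Import Defs.
From HB Require Import structures.
From mathcomp Require Import all_boot all_order all_algebra.
From mathcomp Require Import all_classical all_reals all_analysis.
From mathcomp Require Import ring lra zify.

Set Implicit Arguments.
Unset Strict Implicit.
Unset Printing Implicit Defensive.

Import Order.TTheory GRing.Theory Num.Theory.
Local Open Scope ring_scope.

(** Both bounds come from comparing effective resistances with diameters.
    If [(h x - h y)^2 <= rho * energy h] for every function [h] on the vertices
    (that is, all effective resistances are [O(rho)]), then all hitting times are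
    [O(rho n Delta)], and a union bound over geometric tails gives
    [COV = O(rho n Delta log n)]; the rumor travels one edge per step, so the
    broadcast time is at least the eccentricity of its source.

    For [d >= sqrt n] take the circulant graph joining [x] to [x +- s] for
    [s <= d / 2], plus the antipodal matching when [d] is odd.  It is a chain of
    [O(n / d)] blocks of size of order [d], consecutive blocks being completely
    joined, so [rho = O(1 / d + n / d^3) = O(1 / d)], and its diameter is of order
    [n / d].

    For [3 <= d <= sqrt n] take a circulant graph that is the blow-up, by blocks
    of size [l] of order [d], of a two dimensional grid of width about
    [sqrt n / (2 l)] wound as a helix, and add or delete one edge.  Averaging over
    growing rows and then over sliding windows gives [rho = O(log n / d)], while
    the diameter is of order [sqrt n].  For [d = 2] a brickwork replaces the
    grid. *)

(** * Stopping times of finite Markov chains *)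

Lemma sum_tuple_cons (R : realType) (S : finType) (t : nat) (G : seq S -> R) :
  \sum_(p : t.+1.-tuple S) G p = \sum_y \sum_(p : t.-tuple S) G (y :: p).
Proof.
rewrite pair_bigA /=.
rewrite (reindex (fun yp : S * t.-tuple S => [tuple of yp.1 :: yp.2])) //=.
exists (fun p : t.+1.-tuple S => (thead p, [tuple of behead p])).
  by case=> y p _; congr pair; apply: val_inj.
by move=> p _; rewrite [in RHS](tuple_eta p); apply: val_inj.
Qed.

Lemma sum_tuple0 (R : realType) (S : finType) (G : seq S -> R) :
  \sum_(p : 0.-tuple S) G p = G [::].
Proof.
rewrite (eq_bigr (fun=> G [::])) => [|p _]; last by rewrite tuple0.
by rewrite sumr_const card_tuple expn0.
Qed.

Lemma sum_tuple_rcons (R : realType) (S : finType) (t : nat) (G : seq S -> R) :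
  \sum_(p : t.+1.-tuple S) G p =
  \sum_(p : t.-tuple S) \sum_y G (rcons p y).
Proof.
elim: t G => [|t IH] G.
  rewrite sum_tuple_cons (sum_tuple0 (fun p => \sum_y G (rcons p y))).
  by apply: eq_bigr => y _; rewrite (sum_tuple0 (fun p => G (y :: p))).
rewrite sum_tuple_cons.
rewrite (sum_tuple_cons _ (fun p => \sum_z G (rcons p z))).
by apply: eq_bigr => y _; rewrite (IH (fun p => G (y :: p))).
Qed.

Lemma path_prob_rcons (R : realType) (S : finType) (K : S -> S -> R) x p y :
  path_prob K x (rcons p y) = path_prob K x p * K (last x p) y.
Proof.
by elim: p x => [|z p IH] x /=; rewrite ?mulr1 ?mul1r // IH mulrA.
Qed.

(** Unlike in [first_time], the prefixes range up to [p] itself, so that [survival] at [t] is the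
    probability that the stopping time exceeds [t]. *)
Definition alive (S : finType) (Q : S -> seq S -> bool) (x : S) (p : seq S) :=
  [forall k : 'I_(size p).+1, ~~ Q x (take k p)].

Lemma alive_rcons (S : finType) (Q : S -> seq S -> bool) x p y :
  alive Q x (rcons p y) = alive Q x p && ~~ Q x (rcons p y).
Proof.
apply/forallP/andP => [H|[/forallP Hp Hy] k].
  split; last first.
    by have := H ord_max; rewrite /= take_size.
  apply/forallP => k; have lk : (k < (size (rcons p y)).+1)%N.
    by rewrite size_rcons; apply: leqW.
  by have := H (Ordinal lk); rewrite /= -cats1 takel_cat // -ltnS.
case: k => k /=; rewrite size_rcons ltnS leq_eqVlt => /orP[/eqP ->|lk].
  by rewrite -(size_rcons p y) take_size.
by rewrite -cats1 takel_cat //; apply: (Hp (Ordinal lk)).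
Qed.

Lemma first_time_rcons (S : finType) (Q : S -> seq S -> bool) x p y :
  first_time Q x (rcons p y) = alive Q x p && Q x (rcons p y).
Proof.
rewrite /first_time andbC; congr andb.
have sz : size (rcons p y) = (size p).+1 by rewrite size_rcons.
apply/forallP/forallP => H k.
  case: k => k kp; have lk : (k < size (rcons p y))%N by rewrite sz.
  by have := H (Ordinal lk); rewrite /= -cats1 takel_cat // -ltnS.
case: k => k; rewrite sz => lk.
by have := H (Ordinal lk); rewrite /= -cats1 takel_cat // -ltnS.
Qed.

Definition survival (R : realType) (S : finType) (K : S -> S -> R)
    (Q : S -> seq S -> bool) (x : S) (t : nat) : R :=
  \sum_(p : t.-tuple S | alive Q x p) path_prob K x p.

Definition stochastic (R : realType) (S : finType) (K : S -> S -> R) :=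
  (forall x y, 0 <= K x y) /\ (forall x, \sum_y K x y = 1).

Section Chain.
Variables (R : realType) (S : finType) (K : S -> S -> R).
Hypothesis stK : stochastic K.
Variables (Q : S -> seq S -> bool) (x : S).

Lemma path_prob_ge0 y p : 0 <= path_prob K y p.
Proof. by elim: p y => //= z p IH y; apply: mulr_ge0 => //; case: stK. Qed.

Lemma prob_time_ge0 t : 0 <= prob_time K Q x t.
Proof. by apply: sumr_ge0 => p _; apply: path_prob_ge0. Qed.

Lemma survival_ge0 t : 0 <= survival K Q x t.
Proof. by apply: sumr_ge0 => p _; apply: path_prob_ge0. Qed.

Lemma prob_time0 : prob_time K Q x 0 = 1 - survival K Q x 0.
Proof.
rewrite /prob_time /survival big_mkcond [in RHS]big_mkcond /=.
rewrite (sum_tuple0 (fun p => if first_time Q x p then path_prob K x p else 0)).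
rewrite (sum_tuple0 (fun p => if alive Q x p then path_prob K x p else 0)) /=.
have -> : first_time Q x [::] = Q x [::].
  by rewrite /first_time; case: (Q _ _) => //=; apply/forallP => -[].
have -> : alive Q x [::] = ~~ Q x [::].
  by apply/forallP/idP => [/(_ ord0)|H k].
by case: (Q x [::]); rewrite /= ?subr0 ?subrr.
Qed.

Lemma prob_timeS t :
  prob_time K Q x t.+1 = survival K Q x t - survival K Q x t.+1.
Proof.
rewrite /prob_time /survival big_mkcond [X in _ - X]big_mkcond /=.
rewrite (sum_tuple_rcons t
  (fun p => if first_time Q x p then path_prob K x p else 0)).
rewrite (sum_tuple_rcons t
  (fun p => if alive Q x p then path_prob K x p else 0)).
rewrite [X in X - _]big_mkcond -sumrB; apply: eq_bigr => p _ /=.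
case: ifPn => [ap|nap]; last first.
  rewrite !big1 ?subrr // => y _.
  - by rewrite alive_rcons (negbTE nap).
  - by rewrite first_time_rcons (negbTE nap).
rewrite -{1}[path_prob K x p]mulr1 -(stK.2 (last x p)) mulr_sumr -sumrB.
apply: eq_bigr => y _; rewrite first_time_rcons alive_rcons ap /=.
by rewrite path_prob_rcons; case: (Q _ _) => /=; rewrite ?subr0 ?subrr.
Qed.

Lemma sum_prob_time M :
  \sum_(0 <= t < M.+1) prob_time K Q x t = 1 - survival K Q x M.
Proof.
elim: M => [|M IH]; first by rewrite big_nat1 prob_time0.
rewrite big_nat_recr //= IH prob_timeS; ring.
Qed.

(** Summation by parts turns the truncated expectation into a sum of tails; the boundary term only
    helps an upper bound. *)
Lemma sum_time_prob_time M :
  \sum_(0 <= t < M.+1) t%:R * prob_time K Q x t =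
  \sum_(0 <= t < M) survival K Q x t - M%:R * survival K Q x M.
Proof.
elim: M => [|M IH]; first by rewrite big_nat1 big_nil !mul0r subrr.
rewrite big_nat_recr //= IH prob_timeS big_nat_recr //= -natr1; ring.
Qed.

Lemma survival_le1 M : survival K Q x M <= 1.
Proof.
rewrite -subr_ge0 -sum_prob_time; apply: sumr_ge0 => t _.
exact: prob_time_ge0.
Qed.

Lemma survival_antimono s t : (s <= t)%N ->
  survival K Q x t <= survival K Q x s.
Proof.
move=> /subnKC <-; elim: (t - s)%N => [|k IH]; first by rewrite addn0.
apply: le_trans IH; rewrite addnS -subr_ge0 -prob_timeS.
exact: prob_time_ge0.
Qed.

(** Tails decrease, so [M * survival M <= B] and the survival probability tends to zero: the
    stopping time is almost surely finite and the infinite summand vanishes. *)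
Lemma expected_time_le (B : R) :
  (forall M, \sum_(0 <= t < M) survival K Q x t <= B) ->
  (expected_time K Q x <= B%:E)%E.
Proof.
move=> HB; rewrite /expected_time.
have B0 : 0 <= B by have := HB 0%N; rewrite big_nil.
have p0 t : (0 <= (prob_time K Q x t)%:E)%E by rewrite lee_fin prob_time_ge0.
have -> : (\sum_(0 <= t <oo) (prob_time K Q x t)%:E = 1)%E.
  apply/eqP; rewrite eq_le; apply/andP; split.
    apply: lime_le; first exact: is_cvg_nneseries.
    near=> M; rewrite sumEFin lee_fin.
    apply: (@le_trans _ _ (\sum_(0 <= t < M.+1) prob_time K Q x t)).
      by rewrite big_nat_recr //= lerDl prob_time_ge0.
    by rewrite sum_prob_time gerBl survival_ge0.
  apply/lee_addgt0Pr => eps eps0.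
  pose M := (Num.truncn (B / eps)).+1.
  have M0 : (0 : R) < M%:R by rewrite ltr0n.
  have sM : survival K Q x M <= eps.
    have h1 : M%:R * survival K Q x M <= B.
      apply: le_trans (HB M); rewrite mulr_natl.
      rewrite -[M in X in X <= _]subn0 -sumr_const_nat.
      apply: ler_sum_nat => i /andP[_ iM]; apply: survival_antimono.
      exact: ltnW.
    have h2 : B / eps < M%:R by apply: truncnS_gt.
    rewrite -(ler_pM2l M0); apply: le_trans h1 _.
    by rewrite -ler_pdivrMr // ltW.
  apply: (@le_trans _ _ ((\sum_(0 <= t < M.+1) prob_time K Q x t)%:E + eps%:E)%E).
    by rewrite -EFinD lee_fin sum_prob_time; lra.
  apply: leeD2r; rewrite -sumEFin; apply: nneseries_lim_ge => t _ _.
  exact: p0.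
rewrite subee // mule0 adde0.
apply: lime_le.
  by apply: is_cvg_nneseries => t _ _; rewrite lee_fin mulr_ge0 // prob_time_ge0.
near=> M; rewrite sumEFin lee_fin.
apply: (@le_trans _ _ (\sum_(0 <= t < M.+1) t%:R * prob_time K Q x t)).
  by rewrite big_nat_recr //= lerDl mulr_ge0 // prob_time_ge0.
rewrite sum_time_prob_time; apply: le_trans (HB M).
by rewrite gerBl mulr_ge0 // survival_ge0.
Unshelve. all: by end_near.
Qed.

(** If the total mass [P] is [1], every term satisfies [t * prob_time t >= D * prob_time t]; if
    [P < 1], the infinite summand makes the expectation [+oo]. *)
Lemma expected_time_ge (D : R) : 0 <= D ->
  (forall t, t%:R < D -> prob_time K Q x t = 0) ->
  (D%:E <= expected_time K Q x)%E.
Proof.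
move=> D0 HD; rewrite /expected_time.
have p0 t : (0 <= (prob_time K Q x t)%:E)%E by rewrite lee_fin prob_time_ge0.
have tp0 t : (0 <= (t%:R * prob_time K Q x t)%:E)%E.
  by rewrite lee_fin mulr_ge0 // prob_time_ge0.
set P := (\sum_(0 <= t <oo) (prob_time K Q x t)%:E)%E.
have P0 : (0 <= P)%E by apply: nneseries_ge0.
have P1 : (P <= 1)%E.
  apply: lime_le; first exact: is_cvg_nneseries.
  near=> M; rewrite sumEFin lee_fin.
  apply: (@le_trans _ _ (\sum_(0 <= t < M.+1) prob_time K Q x t)).
    by rewrite big_nat_recr //= lerDl prob_time_ge0.
  by rewrite sum_prob_time gerBl survival_ge0.
have s0 : (0 <= \sum_(0 <= t <oo) (t%:R * prob_time K Q x t)%:E)%E.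
  exact: nneseries_ge0.
have [PE|Pn] := eqVneq P 1%E.
  rewrite PE subee // mule0 adde0.
  rewrite -[X in (X <= _)%E]mule1 -PE -nneseriesZl //.
  apply: lee_nneseries => [t _ _|t _].
    by rewrite mule_ge0 // lee_fin.
  rewrite -EFinM lee_fin; have [tD|tD] := ltP (t%:R : R) D.
    by rewrite HD // !mulr0.
  by apply: ler_wpM2r => //; exact: prob_time_ge0.
have P1' : (P < 1)%E by rewrite lt_neqAle Pn.
rewrite gt0_mulye ?sube_gt0 // addey ?leey //.
by apply: contraTneq s0 => ->.
Unshelve. all: by end_near.
Qed.

End Chain.

(** * Cover time and broadcast time *)

Lemma walk_stochastic (R : realType) (V : finType) (e : rel V) :
  (forall v, 0 < degree e v)%N -> stochastic (@walk_step R V e).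
Proof.
move=> dpos; split=> [v w|v]; rewrite /walk_step.
  by case: ifP => // _; rewrite invr_ge0.
rewrite -big_mkcond /= sumr_const.
have -> : #|[pred w | e v w]| = degree e v.
  by rewrite /degree /neighbors cardsE.
by rewrite -[LHS]mulr_natr mulVf // pnatr_eq0 -lt0n.
Qed.

Lemma push_stochastic (R : realType) (V : finType) (e : rel V) :
  (forall v, 0 < degree e v)%N -> stochastic (@push_step R V e).
Proof.
move=> /(walk_stochastic R) [w0 w1]; split=> [I J|I].
  by apply: sumr_ge0 => c _; apply: prodr_ge0.
rewrite /push_step (exchange_big_dep xpredT) //=.
rewrite (eq_bigr (fun c : {ffun {v : V | v \in I} -> V} =>
   \prod_(v : {v : V | v \in I}) walk_step R e (val v) (c v))); last first.
  by move=> c _; rewrite (big_pred1 (push c)) // => J; rewrite eq_sym.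
rewrite -(bigA_distr_bigA (fun v : {v : V | v \in I} => walk_step R e (val v))).
by rewrite big1.
Qed.

Section Broadcast.
Variables (R : realType) (V : finType) (e : rel V).
Hypothesis dpos : forall v, (0 < degree e v)%N.
Variables (g : V -> nat) (m : nat).
Hypothesis glip : forall v w, e v w -> (g w <= g v + m)%N.

(** Here [g] stands for the distance from the source and [m] bounds its increase along an edge. A
    nonzero transition probability yields choices whose factors are all nonzero, so each newly
    informed vertex is adjacent to an informed one. *)
Lemma push_step_reach (I J : {set V}) b : push_step R e I J != 0 ->
  (forall v, v \in I -> g v <= b)%N -> forall v, v \in J -> (g v <= b + m)%N.
Proof.
move=> KIJ Ib v vJ.
have [c /andP[/eqP pc]] : exists c : {ffun {v : V | v \in I} -> V},
    (push c == J) && (\prod_v walk_step R e (val v) (c v) != 0).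
  apply/existsP; apply: contraNT KIJ => /existsPn H.
  apply/eqP/big1 => c pc; apply/eqP.
  by have := H c; rewrite pc /= negbK.
rewrite prodf_seq_neq0 => /allP prn.
move: vJ; rewrite -pc /push inE => /orP[/Ib|/imsetP[w _ ->]].
  by move=> h; apply: leq_trans h (leq_addr _ _).
have := prn w (mem_index_enum _); rewrite /walk_step.
case: ifP => [ew _|]; last by rewrite eqxx.
by apply: leq_trans (glip ew) _; rewrite leq_add2r; apply: Ib; case: w {ew}.
Qed.

Lemma broadcast_path_reach (p : seq {set V}) (I : {set V}) b :
  path_prob (@push_step R V e) I p != 0 ->
  (forall v, v \in I -> g v <= b)%N ->
  forall v, v \in last I p -> (g v <= b + size p * m)%N.
Proof.
elim: p I b => [|J p IH] I b /=; first by move=> _ H v /H; rewrite mul0n addn0.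
rewrite mulf_eq0 negb_or => /andP[KIJ Kp] Ib v vl.
by rewrite mulSn addnA; apply: (IH J) => //; exact: (push_step_reach KIJ Ib).
Qed.

Lemma broadcast_time_ge (s u : V) : (0 < m)%N -> g s = 0%N ->
  (((g u)%:R / m%:R)%:E <= broadcast_time R e)%E.
Proof.
move=> m0 gs.
apply: (@le_trans _ _ (broadcast_time_from R e s)); last first.
  exact: (le_bigmax _ (fun s : V => broadcast_time_from R e s) s).
apply: expected_time_ge; first exact: push_stochastic.
  by apply: divr_ge0.
move=> t; rewrite ltr_pdivlMr ?ltr0n // -natrM ltr_nat => tg.
apply: big1 => p /andP[/eqP pl _]; apply/eqP; apply: contraTT tg => pn.
rewrite -leqNgt -(size_tuple p).
have := @broadcast_path_reach p [set s] 0 pn _ u.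
rewrite add0n; apply; last by rewrite pl inE.
by move=> v /set1P ->; rewrite gs.
Qed.
End Broadcast.

(* Each edge is counted twice. *)
Definition energy (R : realType) (V : finType) (e : rel V) (h : V -> R) : R :=
  \sum_x \sum_(y | e x y) (h x - h y) ^+ 2.

(** * Hitting times and cover time from effective resistances *)

Section Cover.
Variables (R : realType) (V : finType) (e : rel V).
Hypothesis esym : symmetric e.
Hypothesis dpos : forall v, (0 < degree e v)%N.
Let K := @walk_step R V e.

(** The probability that the walk from [x] misses [v] at all times from [0] to [t], by conditioning
    on the first step; [avoidE] gives the sum over histories. *)
Fixpoint avoid (v : V) (t : nat) (x : V) : R :=
  (x != v)%:R * (if t is t'.+1 then \sum_y K x y * avoid v t' y else 1).

Lemma K_ge0 x y : 0 <= K x y. Proof. exact: (walk_stochastic R dpos).1. Qed.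
Lemma K_sum x : \sum_y K x y = 1. Proof. exact: (walk_stochastic R dpos).2. Qed.

Lemma avoidE v t x :
  avoid v t x = \sum_(p : t.-tuple V) (v \notin x :: p)%:R * path_prob K x p.
Proof.
elim: t x => [|t IH] x /=.
  rewrite (sum_tuple0 (fun p => (v \notin x :: p)%:R * path_prob K x p)) /=.
  by rewrite inE eq_sym.
rewrite (sum_tuple_cons _ (fun p => (v \notin x :: p)%:R * path_prob K x p)).
rewrite mulr_sumr; apply: eq_bigr => y _; rewrite IH !mulr_sumr.
apply: eq_bigr => p _ /=; rewrite [v \in x :: _]inE negb_or [v == x]eq_sym.
case: (x != v) => /=; rewrite ?mul0r // !mul1r; ring.
Qed.

(** Union bound: if the walk has not covered the graph, some [v] is missing from its history. *)
Lemma survival_cover_le s t :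
  survival K (@visited_all V) s t <= \sum_v avoid v t s.
Proof.
rewrite (eq_bigr _ (fun v _ => avoidE v t s)) exchange_big /= /survival.
rewrite big_mkcond /=; apply: ler_sum => p _; rewrite -mulr_suml.
have pp : 0 <= path_prob K s p by apply: path_prob_ge0 (walk_stochastic R dpos) _ _.
have nn : 0 <= \sum_v (v \notin s :: p)%:R :> R by apply: sumr_ge0.
case: ifP => [/forallP /(_ ord_max)|_]; last exact: mulr_ge0.
rewrite take_size => /forallPn [v vn].
rewrite -[X in X <= _]mul1r; apply: ler_wpM2r => //.
by rewrite (bigD1 v) //= vn lerDl; apply: sumr_ge0.
Qed.

Lemma avoid_ge0 v t x : 0 <= avoid v t x.
Proof.
elim: t x => [|t IH] x /=; apply: mulr_ge0 => //; apply: sumr_ge0 => y _.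
by apply: mulr_ge0; [exact: K_ge0|].
Qed.

Lemma avoid_self v t : avoid v t v = 0.
Proof. by case: t => [|t] /=; rewrite eqxx mul0r. Qed.

Lemma avoid_le1 v t x : avoid v t x <= 1.
Proof.
elim: t x => [|t IH] x /=; first by rewrite mulr1; case: (_ != _).
case: (x != v); rewrite ?mul0r // mul1r -[X in _ <= X](K_sum x).
by apply: ler_sum => y _; rewrite ler_piMr ?K_ge0.
Qed.

Lemma avoid_antimonoS v t x : avoid v t.+1 x <= avoid v t x.
Proof.
elim: t x => [|t IH] x /=; apply: ler_wpM2l => //.
  rewrite -[X in _ <= X](K_sum x); apply: ler_sum => y _.
  by rewrite ler_piMr ?K_ge0 // (avoid_le1 v 0).
by apply: ler_sum => y _; apply: ler_wpM2l; [exact: K_ge0|exact: IH].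
Qed.

Lemma avoid_antimono v s t x : (s <= t)%N -> avoid v t x <= avoid v s x.
Proof.
move=> /subnKC <-; elim: (t - s)%N => [|k IH]; first by rewrite addn0.
by rewrite addnS; apply: le_trans (avoid_antimonoS _ _ _) IH.
Qed.

(** Markov property: after [t] steps the walk must avoid [v] for [s] more, from wherever it
    stands. *)
Lemma avoid_mult v s c : (forall x, avoid v s x <= c) ->
  forall t x, avoid v (t + s) x <= avoid v t x * c.
Proof.
move=> Hc; elim=> [|t IH] x.
  rewrite add0n /= mulr1.
  by have [->|_] := eqVneq x v; rewrite ?avoid_self ?mul0r // mul1r.
rewrite addSn /= -mulrA; apply: ler_wpM2l => //.
rewrite mulr_suml; apply: ler_sum => y _; rewrite -mulrA.
by apply: ler_wpM2l => //; exact: K_ge0.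
Qed.

Lemma avoid_geom v T : (forall x, avoid v T x <= 2^-1) ->
  forall k x, avoid v (k * T) x <= 2^-1 ^+ k.
Proof.
move=> H; elim=> [|k IH] x; first by rewrite mul0n expr0; exact: avoid_le1.
rewrite mulSn addnC exprSr.
apply: le_trans (avoid_mult H _ _) _.
by apply: ler_wpM2r (IH x); rewrite invr_ge0.
Qed.

(* Expected time to hit [v], truncated at time [T]. *)
Definition hit (v : V) (T : nat) (x : V) : R := \sum_(0 <= t < T) avoid v t x.

Lemma hit_ge0 v T x : 0 <= hit v T x.
Proof. by apply: sumr_ge0 => t _; exact: avoid_ge0. Qed.

Lemma hit_self v T : hit v T v = 0.
Proof. by apply: big1 => t _; exact: avoid_self. Qed.

(** First-step analysis. It is an inequality because truncation leaves one extra nonnegative term on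
    the right, and because the left side is zero at [x = v]. *)
Lemma hit_step v T x : hit v T x <= 1 + \sum_y K x y * hit v T y.
Proof.
case: T => [|T].
  rewrite /hit big_nil; apply: addr_ge0 => //; apply: sumr_ge0 => y _.
  by rewrite big_nil mulr0.
rewrite {1}/hit big_nat_recl //; apply: lerD; first exact: avoid_le1.
have -> : \sum_y K x y * hit v T.+1 y =
    \sum_(0 <= t < T.+1) \sum_y K x y * avoid v t y.
  rewrite exchange_big /=; apply: eq_bigr => y _; exact: mulr_sumr.
rewrite [X in _ <= X]big_nat_recr //=.
apply: (@le_trans _ _ (\sum_(0 <= t < T) \sum_y K x y * avoid v t y)).
  apply: ler_sum => t _; rewrite ler_piMl //; last by case: (_ != _).
  by apply: sumr_ge0 => y _; apply: mulr_ge0; [exact: K_ge0|exact: avoid_ge0].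
rewrite lerDl.
by apply: sumr_ge0 => y _; apply: mulr_ge0; [exact: K_ge0|exact: avoid_ge0].
Qed.

(** Discrete Green identity: expand one factor of the square and exchange the endpoints by
    symmetry. *)
Lemma energyE (h : V -> R) :
  energy e h = 2 * \sum_x h x * \sum_(y | e x y) (h x - h y).
Proof.
have E1 : \sum_x \sum_(y | e x y) h y * (h y - h x) =
          \sum_x h x * \sum_(y | e x y) (h x - h y).
  rewrite (exchange_big_dep xpredT) //=; apply: eq_bigr => x _; rewrite mulr_sumr.
  by apply: eq_bigl => y; rewrite esym.
rewrite mulr_natl mulr2n -{2}E1 -big_split /=; apply: eq_bigr => x _.
rewrite mulr_sumr -big_split /=; apply: eq_bigr => y _; ring.
Qed.

Variables (rho : R) (Delta : nat).
Hypothesis rho0 : 0 <= rho.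
Hypothesis resist : forall (h : V -> R) x y, (h x - h y) ^+ 2 <= rho * energy e h.
Hypothesis dle : forall v, (degree e v <= Delta)%N.

Lemma lap_hit v T x : x != v ->
  \sum_(y | e x y) (hit v T x - hit v T y) <= (degree e x)%:R.
Proof.
move=> xv; have dx : (0 : R) < (degree e x)%:R by rewrite ltr0n.
have := hit_step v T x.
have -> : \sum_y K x y * hit v T y =
    (degree e x)%:R^-1 * \sum_(y | e x y) hit v T y.
  rewrite [in RHS]big_mkcond mulr_sumr; apply: eq_bigr => y _.
  by rewrite /K /walk_step; case: ifP => _; rewrite ?mul0r ?mulr0.
rewrite sumrB sumr_const -[_ *+ _]mulr_natl.
have -> : #|[pred y | e x y]| = degree e x.
  by rewrite /degree /neighbors cardsE.
move=> /(ler_wpM2l (ltW dx)); rewrite mulrDr mulr1 mulrA divff ?gt_eqF // mul1r.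
by move=> ?; lra.
Qed.

(* With [M] the maximum of the truncated hitting time [h] of [v], summation by
   parts gives [energy h <= 2 n Delta M], so [M ^ 2 <= rho * energy h] bounds
   [M]. *)
Lemma hit_le v T x : hit v T x <= 2 * rho * #|V|%:R * Delta%:R.
Proof.
have [x0 _ x0max] : {x0 : V | true & forall y, hit v T y <= hit v T x0}.
  case: (@arg_maxP _ _ V v xpredT (hit v T)) => // i _ Hi.
  by exists i => // y; apply: Hi.
apply: le_trans (x0max x) _; set M := hit v T x0.
have M0 : 0 <= M by exact: hit_ge0.
have HE : energy e (hit v T) <= 2 * (#|V|%:R * (Delta%:R * M)).
  rewrite energyE ler_pM2l ?ltr0n //.
  rewrite mulr_natl -sumr_const; apply: ler_sum => y _.
  have [->|yv] := eqVneq y v.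
    by rewrite hit_self mul0r mulr_ge0.
  rewrite mulrC; apply: (@le_trans _ _ ((degree e y)%:R * hit v T y)).
    by apply: ler_wpM2r; [exact: hit_ge0|exact: lap_hit].
  by apply: ler_pM; rewrite ?hit_ge0 ?ler_nat.
have := resist (hit v T) x0 v; rewrite hit_self subr0 -/M => H2.
have H3 : M ^+ 2 <= rho * (2 * (#|V|%:R * (Delta%:R * M))).
  by apply: le_trans H2 _; apply: ler_wpM2l.
have [M00|Mn0] := eqVneq M 0; first by rewrite M00 !mulr_ge0.
have Mp : 0 < M by rewrite lt_def Mn0.
rewrite -(ler_pM2r Mp) -expr2; apply: le_trans H3 _.
by rewrite le_eqVlt; apply/orP; left; apply/eqP; ring.
Qed.

(** Markov's inequality: [avoid] decreases in time, so [T * avoid v T x <= hit v T x], which is at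
    most [T / 2]. *)
Lemma avoid_half v T x : (0 < T)%N ->
  4 * rho * #|V|%:R * Delta%:R <= T%:R -> avoid v T x <= 2^-1.
Proof.
move=> T0 HT; have T0' : (0 : R) < T%:R by rewrite ltr0n.
have h1 : T%:R * avoid v T x <= hit v T x.
  have -> : T%:R * avoid v T x = \sum_(0 <= t < T) avoid v T x.
    by rewrite sumr_const_nat subn0 mulr_natl.
  by apply: ler_sum_nat => i /andP[_ iT]; apply: avoid_antimono; exact: ltnW.
have h2 := hit_le v T x.
rewrite -(ler_pM2l T0'); apply: le_trans h1 _; lra.
Qed.

Lemma sum_blocks (f : nat -> R) T k :
  \sum_(0 <= t < k * T) f t = \sum_(0 <= j < k) \sum_(0 <= i < T) f (j * T + i)%N.
Proof.
elim: k => [|k IH]; first by rewrite !big_nil.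
rewrite [RHS]big_nat_recr //= -IH mulSn addnC (big_cat_nat (leq0n _) (leq_addr _ _)) //=.
congr (_ + _); rewrite -{1}[(k * T)%N]add0n big_addn addKn.
by apply: eq_bigr => i _; rewrite addnC.
Qed.

(** The first [L] terms are at most [1]; from there on the terms are dominated by a geometric series
    of sum [2]. *)
Lemma sum_min_geom k L : (#|V| <= 2 ^ L)%N ->
  \sum_(0 <= j < k) Num.min 1 (#|V|%:R * 2^-1 ^+ j) <= L%:R + 2 :> R.
Proof.
move=> VL; set f := fun j : nat => Num.min 1 (#|V|%:R * 2^-1 ^+ j) : R.
have f0 j : 0 <= f j by rewrite /f le_min ler01 mulr_ge0 // exprn_ge0 // invr_ge0.
have pos i : (0 : R) < 2^-1 ^+ i by rewrite exprn_gt0 // invr_gt0.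
have tail i : \sum_(0 <= j < i) f (L + j)%N <= 2 - 2^-1 ^+ i * 2.
  elim: i => [|i IH]; first by rewrite big_nil expr0; lra.
  rewrite big_nat_recr //=.
  have : f (L + i)%N <= 2^-1 ^+ i.
    rewrite /f ge_min; apply/orP; right; rewrite exprD mulrA.
    apply: ler_piMl; first exact: ltW.
    by rewrite exprVn ler_pdivrMr ?exprn_gt0 // mul1r -natrX ler_nat.
  rewrite exprS; move: IH; set a := 2^-1 ^+ i; set b := \sum_(_ <= _ < _) _.
  by move=> IH Hf; lra.
have le1 : \sum_(0 <= j < k) f j <= \sum_(0 <= j < L + k) f j.
  rewrite addnC (big_cat_nat (leq0n _) (leq_addr _ _)) //= lerDl.
  by apply: sumr_ge0.
apply: le_trans le1 _.
rewrite (big_cat_nat (leq0n _) (leq_addr _ _)) //=; apply: lerD.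
  rewrite -[L in X in _ <= X]subn0 -[X in _ <= X]sumr_const_nat.
  by apply: ler_sum => j _; rewrite /f ge_min lexx.
rewrite -{1}[L]add0n big_addn addKn.
rewrite (eq_bigr (fun j => f (L + j)%N)) => [|j _]; last by rewrite addnC.
by apply: le_trans (tail k) _; have := pos k; lra.
Qed.

(** Cut time into blocks of length [T]. Each block halves the probability of missing a given vertex,
    so throughout block [j] the survival probability is at most [min 1 (#|V| / 2 ^ j)]. *)
Lemma cover_time_le T L : (0 < T)%N ->
  4 * rho * #|V|%:R * Delta%:R <= T%:R -> (#|V| <= 2 ^ L)%N ->
  (cover_time R e <= (T%:R * (L%:R + 2))%:E)%E.
Proof.
move=> T0 HT VL; apply: bigmax_le => [|s _]; first exact: leNye.
have st := walk_stochastic R dpos.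
apply: expected_time_le => // M.
have s0 t := survival_ge0 st (@visited_all V) s t.
apply: (@le_trans _ _ (\sum_(0 <= t < M * T) survival K (@visited_all V) s t)).
  have MT : (M <= M * T)%N by rewrite leq_pmulr.
  by rewrite (big_cat_nat (leq0n _) MT) //= lerDl sumr_ge0.
rewrite sum_blocks.
apply: le_trans (ler_wpM2l (ler0n _ _) (sum_min_geom M VL)).
rewrite mulr_sumr; apply: ler_sum => j _.
rewrite mulr_natl -[T in X in _ <= X]subn0 -sumr_const_nat.
apply: ler_sum => i _; rewrite le_min survival_le1 //=.
apply: le_trans (survival_antimono st _ _ (leq_addr _ _)) _.
apply: le_trans (survival_cover_le _ _) _.
rewrite mulr_natl -sumr_const; apply: ler_sum => v _.
by apply: avoid_geom => x; apply: avoid_half.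
Qed.

(** The indicator of the component of [x] has zero energy, so a [y] outside it would give
    [1 <= 0]. *)
Lemma resist_connected x y : connect e x y.
Proof.
apply/negPn/negP => nxy.
have := resist (fun z => (connect e x z)%:R) x y.
rewrite connect0 (negbTE nxy) subr0 expr1n /energy big1 ?mulr0 ?lerNgt ?ltr01 //.
  by rewrite leNgt ltr01.
move=> u _; apply: big1 => w uw.
have -> : connect e x u = connect e x w.
  apply/idP/idP => H; apply: connect_trans H (connect1 _) => //.
  by rewrite esym.
by rewrite subrr expr0n.
Qed.

End Cover.

(** * Resistance of a grid *)

Section Sums.
Variable R : realType.

(** Two-term Cauchy-Schwarz: the cross term [2 * x * y] is at most [P * q + p * Q] by the inequality
    of arithmetic and geometric means. It serves as the inductive step for plain and weighted
    sums. *)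
Lemma sqr_add_le (P Q p q x y : R) : 0 <= P -> 0 <= Q -> 0 <= p -> 0 <= q ->
  x ^+ 2 <= P * Q -> y ^+ 2 <= p * q -> (x + y) ^+ 2 <= (P + p) * (Q + q).
Proof.
move=> P0 Q0 p0 q0 xPQ ypq.
have xy : x * y *+ 2 <= P * q + p * Q.
  have s0 : 0 <= P * q + p * Q by rewrite addr_ge0 // mulr_ge0.
  apply: le_trans (ler_norm _) _.
  rewrite -(@ler_pXn2r _ 2) ?nnegrE // real_normK ?num_real //.
  have : (x ^+ 2) * (y ^+ 2) <= (P * Q) * (p * q).
    by apply: ler_pM; rewrite ?sqr_ge0.
  have := sqr_ge0 (P * q - p * Q); rewrite -mulr_natr; nra.
by rewrite sqrrD; lra.
Qed.

Lemma sqr_sum_le (I : Type) (r : seq I) (P : pred I) (f : I -> R) :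
  (\sum_(i <- r | P i) f i) ^+ 2 <=
  (\sum_(i <- r | P i) 1) * \sum_(i <- r | P i) f i ^+ 2.
Proof.
elim: r => [|i r IH]; first by rewrite !big_nil expr0n mul0r.
rewrite !big_cons; case: (P i) => //.
apply: sqr_add_le => //; rewrite ?sqr_ge0 // ?mul1r //.
- by apply: sumr_ge0.
- by apply: sumr_ge0 => j _; exact: sqr_ge0.
Qed.

Lemma sqr_sum_nat_le (m k : nat) (f : nat -> R) :
  (\sum_(m <= i < k) f i) ^+ 2 <= (k - m)%:R * \sum_(m <= i < k) f i ^+ 2.
Proof.
by have := sqr_sum_le (index_iota m k) xpredT f; rewrite sumr_const_nat.
Qed.

Lemma sqr_add3_le (k1 k2 k3 E x y z : R) :
  x ^+ 2 <= k1 * E -> y ^+ 2 <= k2 * E -> z ^+ 2 <= k3 * E ->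
  (x + y + z) ^+ 2 <= 3 * (k1 + k2 + k3) * E.
Proof.
move=> hx hy hz.
have h1 := sqr_ge0 (x - y); have h2 := sqr_ge0 (y - z); have h3 := sqr_ge0 (x - z).
by rewrite expr2 in h1; rewrite expr2 in h2; rewrite expr2 in h3; nra.
Qed.

Lemma sum_nat_subrange (f : nat -> R) (z m M : nat) : (forall t, 0 <= f t) ->
  (z + m <= M)%N -> \sum_(0 <= t < m) f (z + t)%N <= \sum_(0 <= t < M) f t.
Proof.
move=> f0 zmM; rewrite (big_cat_nat (leq0n z) (leq_trans (leq_addr m z) zmM)) /=.
rewrite (big_cat_nat (leq_addr m z) zmM) /=.
rewrite -{3}[z]add0n big_addn addKn.
rewrite [X in _ <= _ + (X + _)](eq_bigr (fun t => f (z + t)%N)) => [|t _].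
  by rewrite addrCA lerDl addr_ge0 // sumr_ge0.
by rewrite addnC.
Qed.

Definition mean (k : nat) (b : nat -> R) : R :=
  (\sum_(0 <= s < k) b s) / k%:R.

Lemma mean_diff k (b c : nat -> R) : (0 < k)%N ->
  (mean k b - mean k c) ^+ 2 <= k%:R^-1 * \sum_(0 <= s < k) (b s - c s) ^+ 2.
Proof.
move=> k0; have k0' : (0 : R) < k%:R by rewrite ltr0n.
rewrite /mean -mulrBl -sumrB exprMn -[X in _ <= X * _]mul1r.
have := sqr_sum_nat_le 0 k (fun s => b s - c s); rewrite subn0 => H.
rewrite exprVn ler_pdivrMr ?exprn_gt0 //.
apply: le_trans H _; rewrite le_eqVlt; apply/orP; left; apply/eqP.
by field; rewrite gt_eqF.
Qed.

Lemma sum_by_parts k (b : nat -> R) :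
  \sum_(0 <= s < k) s.+1%:R * (b s.+1 - b s) =
  k%:R * b k - \sum_(0 <= s < k) b s.
Proof.
elim: k => [|k IH]; first by rewrite !big_nil mul0r subrr.
by rewrite !big_nat_recr //= IH -natr1; ring.
Qed.

(** By Abel summation the two means differ by the sum of the increments [b s.+1 - b s] with weights
    [s.+1 / (k.+1 * k.+2)], each at most [1 / k.+2]; then Cauchy-Schwarz applies. *)
Lemma mean_widen k (b : nat -> R) :
  (mean k.+2 b - mean k.+1 b) ^+ 2 <=
  k.+1%:R^-1 * \sum_(0 <= s < k.+1) (b s.+1 - b s) ^+ 2.
Proof.
set D := \sum_(0 <= s < k.+1) (b s.+1 - b s) ^+ 2.
have k1 : (0 : R) < k.+1%:R by rewrite ltr0n.
have k2 : (0 : R) < k.+2%:R by rewrite ltr0n.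
have D0 : 0 <= D by apply: sumr_ge0 => s _; exact: sqr_ge0.
have -> : mean k.+2 b - mean k.+1 b =
    (\sum_(0 <= s < k.+1) s.+1%:R * (b s.+1 - b s)) / (k.+1%:R * k.+2%:R).
  rewrite sum_by_parts /mean big_nat_recr //= -[k.+2%:R]natr1.
  rewrite -[k.+2%:R]natr1 in k2; move: k1 k2; set K := k.+1%:R => k1 k2.
  by field; rewrite !gt_eqF.
rewrite expr_div_n ler_pdivrMr ?exprn_gt0 ?mulr_gt0 //.
apply: le_trans (sqr_sum_nat_le _ _ _) _; rewrite subn0.
apply: (@le_trans _ _ (k.+1%:R * (k.+1%:R ^+ 2 * D))).
  rewrite ler_pM2l // mulr_sumr; apply: ler_sum_nat => s /andP[_ sk].
  rewrite exprMn; apply: ler_wpM2r; first exact: sqr_ge0.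
  by rewrite lerXn2r ?nnegrE ?ler0n // ler_nat.
have -> : k.+1%:R^-1 * D * (k.+1%:R * k.+2%:R) ^+ 2 =
    k.+1%:R * (k.+2%:R ^+ 2 * D) by field; rewrite gt_eqF.
rewrite ler_pM2l //; apply: ler_wpM2r => //.
by rewrite lerXn2r ?nnegrE ?ler0n // ler_nat.
Qed.

Definition harmonic_sum (k : nat) : R := \sum_(0 <= j < k) j.+1%:R^-1.

(** The inductive step is [ln (1 + t) <= t] at [t = - 1 / k.+2]. *)
Lemma harmonic_sum_le k : (0 < k)%N -> harmonic_sum k <= 1 + ln k%:R.
Proof.
case: k => // k _; elim: k => [|k IH].
  by rewrite /harmonic_sum big_nat1 invr1 ln1 addr0.
rewrite /harmonic_sum big_nat_recr //= -/(harmonic_sum _).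
have k1 : (0 : R) < k.+1%:R by rewrite ltr0n.
have k2 : (0 : R) < k.+2%:R by rewrite ltr0n.
have : ln (1 + - k.+2%:R^-1) <= - k.+2%:R^-1 :> R.
  by apply: le_ln1Dx; rewrite ltrN2 invf_lt1 // ltr1n.
have -> : 1 + - k.+2%:R^-1 = k.+1%:R / k.+2%:R :> R.
  rewrite -[k.+2%:R]natr1; move: k2; rewrite -[k.+2%:R]natr1.
  by set K := k.+1%:R => k2; field; rewrite gt_eqF.
rewrite ln_div ?posrE //.
by move: IH; set u := harmonic_sum _; set v := k.+2%:R^-1; lra.
Qed.

End Sums.

(* The grid is wound as a helix: position [t] is joined to [t + 1] and [t + W]. *)
Section Grid.
Variables (R : realType) (N W : nat).
Hypothesis W0 : (0 < W)%N.

Definition shift_energy (a : nat -> R) (c : nat) : R :=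
  \sum_(0 <= t < N - c) (a (t + c)%N - a t) ^+ 2.

Definition grid_energy a := shift_energy a 1 + shift_energy a W.

Lemma shift_energy_ge0 a c : 0 <= shift_energy a c.
Proof. by apply: sumr_ge0 => t _; exact: sqr_ge0. Qed.

(* A unit of flow from [x] is spread evenly over row [k] of a triangle with apex
   [x]; going from row [k] to the next costs [O(1 / k)], whence the logarithm. *)
Let row (a : nat -> R) x k := mean k.+1 (fun s => a (x + k * W + s)%N).
Let up (a : nat -> R) x k :=
  \sum_(0 <= s < k.+1) (a (x + k * W + s + W)%N - a (x + k * W + s)%N) ^+ 2.
Let across (a : nat -> R) x k :=
  \sum_(0 <= s < k.+1) (a (x + k.+1 * W + s.+1)%N - a (x + k.+1 * W + s)%N) ^+ 2.

Lemma row_step a x k :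
  (row a x k.+1 - row a x k) ^+ 2 <= k.+1%:R^-1 * (2 * (up a x k + across a x k)).
Proof.
(* [mid] averages over the first [k + 1] positions of row [k + 1]: edges of length [W] compare it
   with row [k], edges of length [1] with the whole row [k + 1]. *)
set mid := mean k.+1 (fun s => a (x + k.+1 * W + s)%N).
have h1 : (row a x k.+1 - mid) ^+ 2 <= k.+1%:R^-1 * across a x k.
  exact: (mean_widen k (fun s => a (x + k.+1 * W + s)%N)).
have h2 : (mid - row a x k) ^+ 2 <= k.+1%:R^-1 * up a x k.
  apply: le_trans (mean_diff _ _ (ltn0Sn k)) _.
  rewrite le_eqVlt; apply/orP; left; apply/eqP; congr (_ * _).
  by apply: eq_bigr => s _; congr ((a _ - _) ^+ 2); lia.
have h3 := sqr_ge0 ((row a x k.+1 - mid) - (mid - row a x k)).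
have -> : row a x k.+1 - row a x k = (row a x k.+1 - mid) + (mid - row a x k).
  ring.
move: h1 h2 h3; set p := row a x k.+1 - mid; set q := mid - _.
set u := up a x k; set v := across a x k; set w := _^-1.
rewrite !expr2 => h1 h2 h3. nra.
Qed.

(** Weighted Cauchy-Schwarz over the successive rows; the weights [1 / j.+1] add up to the harmonic
    sum. *)
Lemma row_apex a x k : (row a x k - a x) ^+ 2 <=
  harmonic_sum R k * (2 * \sum_(0 <= j < k) (up a x j + across a x j)).
Proof.
elim: k => [|k IH].
  rewrite /row /mean big_nat1 mul0n !addn0 divr1 subrr expr0n /=.
  by rewrite /harmonic_sum big_nil mul0r.
have -> : row a x k.+1 - a x = (row a x k - a x) + (row a x k.+1 - row a x k).
  ring.
have nn j : 0 <= up a x j + across a x j.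
  by apply: addr_ge0; apply: sumr_ge0 => s _; exact: sqr_ge0.
rewrite /harmonic_sum !big_nat_recr //= -/(harmonic_sum _ _) mulrDr.
apply: sqr_add_le => //; last exact: row_step.
- by apply: sumr_ge0 => j _; rewrite invr_ge0.
- by rewrite mulr_ge0 // sumr_ge0.
- by rewrite mulr_ge0.
Qed.

(** Row [j] has at most [W] positions, so it fits in the [j]-th stretch of length [W] after [z]; the
    rows are disjoint and no edge is counted twice. *)
Lemma triangle_le (F : nat -> R) z k M : (forall t, 0 <= F t) -> (k <= W)%N ->
  (z + k * W <= M)%N ->
  \sum_(0 <= j < k) \sum_(0 <= s < j.+1) F (z + j * W + s)%N <=
  \sum_(0 <= t < M) F t.
Proof.
move=> F0 kW zM; apply: le_trans (sum_nat_subrange F0 zM).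
rewrite sum_blocks; apply: ler_sum_nat => j /andP[_ jk].
have jW : (j.+1 <= W)%N by apply: leq_trans kW.
rewrite [X in _ <= X](big_cat_nat (leq0n _) jW) /=.
rewrite (eq_bigr (fun s => F (z + (j * W + s))%N)) => [|s _]; last by rewrite addnA.
by rewrite lerDl sumr_ge0.
Qed.

(** Row [W - 1] of the triangle has exactly [W] positions, so it is a full window. *)
Lemma grow_window a x : (x + W * W < N)%N ->
  (mean W (fun s => a (x + W.-1 * W + s)%N) - a x) ^+ 2 <=
  harmonic_sum R W * (2 * grid_energy a).
Proof.
move=> xN; have := row_apex a x W.-1; rewrite /row prednK // => H.
apply: le_trans H _; apply: ler_pM.
- by apply: sumr_ge0 => j _; rewrite invr_ge0.
- rewrite mulr_ge0 // sumr_ge0 // => j _.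
  by apply: addr_ge0; apply: sumr_ge0 => s _; exact: sqr_ge0.
- by rewrite /harmonic_sum -{2}(prednK W0) big_nat_recr //= lerDl invr_ge0.
rewrite ler_pM2l ?ltr0n // big_split /= addrC; apply: lerD.
  pose F t := (a (t + 1)%N - a t) ^+ 2.
  have F0 t : 0 <= F t by exact: sqr_ge0.
  (* The edges of length [1] are used from row [1] on, hence the offset [x + W]. *)
  have hM : (x + W + W.-1 * W <= N - 1)%N by nia.
  apply: le_trans (triangle_le F0 (leq_pred W) hM).
  rewrite le_eqVlt; apply/orP; left; apply/eqP.
  apply: eq_bigr => j _; apply: eq_bigr => s _.
  by rewrite /F mulSn !addnA addn1 addnS.
pose F t := (a (t + W)%N - a t) ^+ 2.
have F0 t : 0 <= F t by exact: sqr_ge0.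
by apply: (@triangle_le F x W.-1 (N - W) F0 (leq_pred _)); nia.
Qed.

(** Sliding a window by one position trades [a (z + t)] for [a (z + t + W)], so only edges of length
    [W] occur, each once. *)
Lemma window_shift (a : nat -> R) z m :
  \sum_(0 <= s < W) a (z + m + s)%N - \sum_(0 <= s < W) a (z + s)%N =
  \sum_(0 <= t < m) (a (z + t + W)%N - a (z + t)%N).
Proof.
elim: m => [|m IH]; first by rewrite big_nil addn0 subrr.
rewrite [RHS]big_nat_recr //= -IH.
have E : \sum_(0 <= s < W.+1) a (z + m + s)%N = \sum_(0 <= s < W.+1) a (z + m + s)%N by [].
rewrite {1}big_nat_recl // big_nat_recr //= addn0 in E.
have -> : \sum_(0 <= s < W) a (z + m.+1 + s)%N = \sum_(0 <= s < W) a (z + m + s.+1)%N.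
  by apply: eq_bigr => s _; congr a; lia.
by move: E; set p := \sum_(_ <= _ < _) _; set q := \sum_(_ <= _ < _) _; lra.
Qed.

Lemma slide_window (a : nat -> R) z z' : (z <= z')%N -> (z' + W <= N)%N ->
  (mean W (fun s => a (z' + s)%N) - mean W (fun s => a (z + s)%N)) ^+ 2 <=
  N%:R / W%:R ^+ 2 * grid_energy a.
Proof.
move=> zz' zN; have W0' : (0 : R) < W%:R by rewrite ltr0n.
rewrite /mean -mulrBl -(subnKC zz') window_shift expr_div_n [X in _ <= X]mulrAC.
rewrite ler_pM2r ?invr_gt0 ?exprn_gt0 //.
apply: le_trans (sqr_sum_nat_le _ _ _) _; rewrite subn0.
apply: ler_pM => //; first by apply: sumr_ge0 => t _; exact: sqr_ge0.
  by rewrite ler_nat; lia.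
apply: (@le_trans _ _ (shift_energy a W)).
  apply: (@sum_nat_subrange R (fun t => (a (t + W)%N - a t) ^+ 2)); last by lia.
  by move=> t; exact: sqr_ge0.
by rewrite /grid_energy lerDr shift_energy_ge0.
Qed.

Lemma shift_energy_rev (a : nat -> R) c :
  shift_energy (fun t => a (N - t.+1)%N) c = shift_energy a c.
Proof.
rewrite /shift_energy big_nat_rev /=; apply: eq_big_nat => t /andP[_ tN].
rewrite -sqrrN opprB; congr ((a _ - a _) ^+ 2); lia.
Qed.

Lemma mean_rev (a : nat -> R) z : (z + W <= N)%N ->
  mean W (fun s => a (N - (z + s).+1)%N) = mean W (fun s => a (N - z - W + s)%N).
Proof.
move=> zN; rewrite /mean; congr (_ / _); rewrite big_nat_rev /=.
by apply: eq_big_nat => t /andP[_ tN]; congr a; lia.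
Qed.

(** As [2 * W ^ 2 <= N], there is room for the triangle either after [x] or, in the reversed order,
    before it. *)
Lemma reach_window a x : (2 * (W * W) <= N)%N -> (x < N)%N ->
  exists2 z, (z + W <= N)%N &
    (mean W (fun s => a (z + s)%N) - a x) ^+ 2 <= harmonic_sum R W * (2 * grid_energy a).
Proof.
move=> WN xN; case: (ltnP (x + W * W) N) => h.
  by exists (x + W.-1 * W)%N; [nia | exact: grow_window].
have h' : (N - x.+1 + W * W < N)%N by nia.
have := @grow_window (fun t => a (N - t.+1)%N) _ h'.
rewrite mean_rev; last by nia.
have -> : (N - (N - x.+1).+1)%N = x by lia.
rewrite /grid_energy !shift_energy_rev => H.
by exists (N - (N - x.+1 + W.-1 * W) - W)%N => //; nia.
Qed.

(** Go from [x] to a window, slide to the window reached from [y], and come back down to [y]. *)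
Lemma grid_resist a x y : (2 * (W * W) <= N)%N -> (x < N)%N -> (y < N)%N ->
  (a x - a y) ^+ 2 <= (12 * harmonic_sum R W + 3 * (N%:R / W%:R ^+ 2)) * grid_energy a.
Proof.
move=> WN xN yN.
have [z zN hz] := reach_window a WN xN; have [z' z'N hz'] := reach_window a WN yN.
set E := grid_energy a in hz hz' *; set H := harmonic_sum R W in hz hz' *.
set mz := mean W _ in hz; set mz' := mean W _ in hz'.
have hs : (mz - mz') ^+ 2 <= N%:R / W%:R ^+ 2 * E.
  case: (leqP z z') => zz'; last by apply: slide_window => //; exact: ltnW.
  by rewrite -sqrrN opprB; apply: slide_window.
have h1 : (a x - mz) ^+ 2 <= (H * 2) * E by rewrite -sqrrN opprB -mulrA.
have h2 : (mz' - a y) ^+ 2 <= (H * 2) * E by rewrite -mulrA.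
have := sqr_add3_le h1 hs h2.
have -> : a x - mz + (mz - mz') + (mz' - a y) = a x - a y by ring.
move=> h; apply: le_trans h _; rewrite le_eqVlt; apply/orP; left; apply/eqP; ring.
Qed.

End Grid.

(** * Resistance of blow-ups of paths and grids *)

Lemma sum_ord_itv (n a b : nat) : (a <= b)%N -> (b <= n)%N ->
  (\sum_(u < n) (a <= u < b) = b - a)%N.
Proof.
move=> ab bn; rewrite -(big_mkord xpredT (fun u => (a <= u < b) : nat)).
rewrite (big_cat_nat (leq0n a) (leq_trans ab bn)) (big_cat_nat ab bn) /=.
rewrite [X in (X + _)%N]big_nat [X in (X + _)%N]big1 => [|i ia]; last first.
  by apply/eqP; rewrite eqb0; lia.
rewrite [X in (_ + (_ + X))%N]big_nat [X in (_ + (_ + X))%N]big1 => [|i ib]; last first.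
  by apply/eqP; rewrite eqb0; lia.
rewrite big_nat (eq_bigr (fun=> 1%N)) => [|i ->] //.
by rewrite -big_nat sum_nat_const_nat; lia.
Qed.

Lemma card_ord_itv (n a b : nat) : (a <= b)%N -> (b <= n)%N ->
  #|[pred u : 'I_n | (a <= u < b)%N]| = (b - a)%N.
Proof.
move=> ab bn; rewrite -(sum_ord_itv ab bn) -sum1_card big_mkcond /=.
by apply: eq_bigr => u _; rewrite inE; case: (_ <= _ < _)%N.
Qed.

Section Energy.
Variables (R : realType) (n : nat) (e : rel 'I_n) (h : 'I_n -> R).

Lemma energy_ge0 : 0 <= energy e h.
Proof. by apply: sumr_ge0 => u _; apply: sumr_ge0 => v _; exact: sqr_ge0. Qed.

Lemma energy_row u : \sum_(v | e u v) (h u - h v) ^+ 2 <= energy e h.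
Proof.
rewrite /energy [X in _ <= X](bigD1 u) //= lerDl; apply: sumr_ge0 => v _.
by apply: sumr_ge0 => w _; exact: sqr_ge0.
Qed.

(** Injectivity of [phi] makes each index charge the part of the energy at a different starting
    vertex. *)
Lemma edges_energy (M : nat) (phi psi : nat -> 'I_n) :
  (forall i j, (i < M)%N -> (j < M)%N -> phi i = phi j -> i = j) ->
  (forall i, (i < M)%N -> e (phi i) (psi i)) ->
  \sum_(0 <= i < M) (h (phi i) - h (psi i)) ^+ 2 <= energy e h.
Proof.
move=> inj ed; pose G u := \sum_(v | e u v) (h u - h v) ^+ 2.
have G0 u : 0 <= G u by apply: sumr_ge0 => v _; exact: sqr_ge0.
rewrite big_mkord; apply: (@le_trans _ _ (\sum_(i < M) G (phi i))).
  apply: ler_sum => i _; rewrite /G (bigD1 (psi i)) /=; last exact: ed.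
  by rewrite lerDl; apply: sumr_ge0 => v _; exact: sqr_ge0.
have injo : {in 'I_M &, injective (fun i : 'I_M => phi i)}.
  by move=> i j _ _ /inj H; apply: val_inj; apply: H.
rewrite -(big_imset G injo) /energy -/G.
rewrite [X in _ <= X](bigID (fun u => u \in [set phi (nat_of_ord i) | i in 'I_M]%SET)) /=.
by rewrite lerDl; apply: sumr_ge0 => u _; exact: G0.
Qed.

Lemma path_resist (a : nat -> R) (N x y : nat) : (x < N)%N -> (y < N)%N ->
  (a x - a y) ^+ 2 <= N%:R * shift_energy N a 1.
Proof.
wlog xy : x y / (x <= y)%N => [H xN yN|].
  case: (leqP x y) => xy; first exact: H.
  by rewrite -sqrrN opprB; apply: H => //; exact: ltnW.
move=> xN yN.
have -> : a x - a y = - \sum_(0 <= t < y - x) (a (x + t + 1)%N - a (x + t)%N).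
  rewrite (eq_bigr (fun t => a (x + t.+1)%N - a (x + t)%N)) => [|t _].
    by rewrite (telescope_sumr (fun t => a (x + t)%N)) // addn0 subnKC // opprB.
  by rewrite addn1 addnS.
rewrite sqrrN; apply: le_trans (sqr_sum_nat_le _ _ _) _; rewrite subn0.
apply: ler_pM => //; first by apply: sumr_ge0 => t _; exact: sqr_ge0.
  by rewrite ler_nat; lia.
apply: (@sum_nat_subrange R (fun t => (a (t + 1)%N - a t) ^+ 2)); last by lia.
by move=> t; exact: sqr_ge0.
Qed.

Variable l : nat.
Hypothesis l0 : (0 < l)%N.
Let N := (n %/ l)%N.

(* The vertices left over when [l] does not divide [n] lie in no block [b < N]. *)
Definition block (b : nat) : pred 'I_n := [pred u : 'I_n | (u %/ l == b)%N].

Definition block_mean (b : nat) : R := (\sum_(u in block b) h u) / l%:R.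

Lemma card_block b : (b < N)%N -> #|block b| = l.
Proof.
move=> bN; have bl : (b.+1 * l <= n)%N by rewrite -leq_divRL.
have le : (b * l <= b.+1 * l)%N by rewrite leq_mul2r leqnSn orbT.
have := card_ord_itv le bl; rewrite -mulnBl subSnn mul1n => <-.
apply: eq_card => u; rewrite !inE eqn_leq leq_divRL // -ltnS ltn_divLR //.
by rewrite andbC.
Qed.

Let lR : (0 : R) < l%:R. Proof. by rewrite ltr0n. Qed.

Lemma sum_block1 b : (b < N)%N -> \sum_(u in block b) 1 = l%:R :> R.
Proof. by move=> bN; rewrite sumr_const card_block. Qed.

Lemma point_block u b : (b < N)%N -> (forall v, v \in block b -> v != u -> e u v) ->
  (h u - block_mean b) ^+ 2 <= l%:R^-1 * energy e h.
Proof.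
move=> bN ev.
have -> : h u - block_mean b = (\sum_(v in block b) (h u - h v)) / l%:R.
  rewrite sumrB sumr_const card_block // /block_mean -mulr_natr.
  by field; rewrite gt_eqF.
rewrite expr_div_n ler_pdivrMr ?exprn_gt0 //.
apply: le_trans (sqr_sum_le _ _ _) _; rewrite sum_block1 //.
have -> : l%:R^-1 * energy e h * l%:R ^+ 2 = l%:R * energy e h.
  by field; rewrite gt_eqF.
rewrite ler_pM2l //; apply: le_trans _ (energy_row u).
rewrite big_mkcond [X in _ <= X]big_mkcond /=; apply: ler_sum => v _.
case: ifP => [vb|_]; last by case: ifP; rewrite ?sqr_ge0.
have [->|vu] := eqVneq v u; first by rewrite subrr expr0n; case: ifP.
by rewrite ev.
Qed.

(** The difference of the means is the average of [h u - h v] over all [l ^ 2] pairs; Cauchy-Schwarz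
    is applied once per coordinate. *)
Lemma block_diff b c : (b < N)%N -> (c < N)%N ->
  (block_mean b - block_mean c) ^+ 2 <=
  (\sum_(u in block b) \sum_(v in block c) (h u - h v) ^+ 2) / l%:R ^+ 2.
Proof.
move=> bN cN.
have -> : block_mean b - block_mean c =
    (\sum_(u in block b) \sum_(v in block c) (h u - h v)) / l%:R ^+ 2.
  have -> : \sum_(u in block b) \sum_(v in block c) (h u - h v) =
      (\sum_(u in block b) h u) * l%:R - (\sum_(v in block c) h v) * l%:R.
    rewrite mulr_suml; under eq_bigr => u _.
      rewrite sumrB sumr_const card_block // -mulr_natr; over.
    by rewrite sumrB sumr_const card_block // -[X in _ - X]mulr_natr.
  by rewrite /block_mean; field; rewrite gt_eqF.
rewrite expr_div_n; set S := \sum_(u in block b) \sum_(v in block c) (h u - h v) ^+ 2.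
rewrite ler_pdivrMr ?exprn_gt0 //.
apply: le_trans (sqr_sum_le _ _ _) _; rewrite sum_block1 //.
have -> : S / l%:R ^+ 2 * (l%:R ^+ 2) ^+ 2 = l%:R * (l%:R * S).
  by field; rewrite gt_eqF.
rewrite ler_pM2l // /S mulr_sumr.
apply: ler_sum => u _.
by apply: le_trans (sqr_sum_le _ _ _) _; rewrite sum_block1.
Qed.

(** All [l ^ 2] pairs between blocks [b] and [b + c] are edges, and each [u] lies in at most one
    block, so these edges are disjoint for distinct [b]: the blow-up gains a factor [l ^ 2]. *)
Lemma block_energy c :
  (forall u v : 'I_n, (v %/ l = u %/ l + c)%N -> e u v) ->
  shift_energy N block_mean c <= energy e h / l%:R ^+ 2.
Proof.
move=> ev; pose F u v := (h u - h v) ^+ 2.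
have F0 u v : 0 <= F u v by exact: sqr_ge0.
apply: (@le_trans _ _ ((\sum_(0 <= b < N - c) \sum_(u in block b)
    \sum_(v in block (b + c)%N) F u v) / l%:R ^+ 2)).
  rewrite mulr_suml; apply: ler_sum_nat => b /andP[_ bN].
  by rewrite -sqrrN opprB; apply: block_diff; rewrite -/N; lia.
rewrite ler_pM2r ?invr_gt0 ?exprn_gt0 //.
pose G u := \sum_(v | e u v) F u v.
have G0 u : 0 <= G u by apply: sumr_ge0 => v _; exact: F0.
apply: (@le_trans _ _ (\sum_(b < N - c) \sum_(u in block b) G u)).
  rewrite big_mkord; apply: ler_sum => b _; apply: ler_sum => u.
  rewrite inE => /eqP ub; rewrite /G big_mkcond [X in _ <= X]big_mkcond /=.
  apply: ler_sum => v _; rewrite inE; case: eqP => [vb|_]; last by case: ifP.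
  by rewrite ev // vb ub.
rewrite (exchange_big_dep xpredT) //= /energy -/G; apply: ler_sum => u _.
rewrite big_mkcond /=.
case: (ltnP (u %/ l) (N - c)) => uN.
  rewrite (bigD1 (Ordinal uN)) //= inE eqxx big1 ?addr0 //.
  move=> b bu; rewrite inE ifN // eq_sym; apply: contraNneq bu => bu.
  by apply/eqP/val_inj.
rewrite big1 => [|b _]; first exact: G0.
rewrite inE ifN //.
by apply: contraTneq (ltn_ord b) => <-; rewrite -leqNgt.
Qed.

Hypothesis l_le_n : (l <= n)%N.
Hypothesis band : forall u v : 'I_n,
  u != v -> (v <= u + (2 * l).-1)%N -> (u <= v + (2 * l).-1)%N -> e u v.

Lemma N_gt0 : (0 < N)%N. Proof. by rewrite /N divn_gt0. Qed.

(** A vertex of a full block uses its own block. Each of the fewer than [l] leftover vertices is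
    within [2 * l - 1] of the whole last block, hence the [minn] in the witness. *)
Lemma near_block u : exists2 b, (b < N)%N &
  (h u - block_mean b) ^+ 2 <= l%:R^-1 * energy e h.
Proof.
have := N_gt0 => N0; have un := ltn_ord u.
have eu := divn_eq u l; have mu := ltn_pmod u l0.
have en := divn_eq n l; have mn := ltn_pmod n l0.
exists (minn (u %/ l) N.-1); first by lia.
apply: point_block; first by lia.
move=> v; rewrite inE => /eqP vb; rewrite eq_sym => uv.
have ev := divn_eq v l; have mv := ltn_pmod v l0.
have vn := ltn_ord v; move: vb; rewrite -/N in en.
set qu := (u %/ l)%N in eu *; set qv := (v %/ l)%N in ev *.
set ru := (u %% l)%N in eu mu; set rv := (v %% l)%N in ev mv.
set rn := (n %% l)%N in en mn.
move=> vb; have [ub|ub] : qv = qu \/ (qv = N.-1 /\ qu = N) \/ (N < qu)%N by lia.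
- by apply: band => //; rewrite eu ev ub; lia.
- case: ub => [[ub1 ub2]|ub]; last by nia.
  have e1 : (qu * l = qv * l + l)%N by rewrite ub2 ub1 -(prednK N0) mulSn /= addnC.
  by apply: band => //; lia.
Qed.

Lemma blocks_resist (kappa : R) x y :
  (forall i j, (i < N)%N -> (j < N)%N ->
    (block_mean i - block_mean j) ^+ 2 <= kappa * energy e h) ->
  (h x - h y) ^+ 2 <= 3 * (2 * l%:R^-1 + kappa) * energy e h.
Proof.
move=> H; have [i iN hi] := near_block x; have [j jN hj] := near_block y.
have hj' : (block_mean j - h y) ^+ 2 <= l%:R^-1 * energy e h.
  by rewrite -sqrrN opprB.
have := sqr_add3_le hi (H i j iN jN) hj'.
have -> : h x - block_mean i + (block_mean i - block_mean j) + (block_mean j - h y)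
  = h x - h y by ring.
move=> h1; apply: le_trans h1 _; rewrite le_eqVlt; apply/orP; left; apply/eqP; ring.
Qed.

Lemma adjacent_blocks (u v : 'I_n) : (v %/ l = u %/ l + 1)%N -> e u v.
Proof.
have eu := divn_eq u l; have mu := ltn_pmod u l0.
have ev := divn_eq v l; have mv := ltn_pmod v l0.
move=> vu; rewrite vu mulnDl mul1n in ev.
have uv : u != v by apply/eqP => E; rewrite E in vu; lia.
by apply: band => //; move: eu ev; set p := (_ %/ _ * l)%N; lia.
Qed.

(** Here the block means are only treated as a path of [n %/ l] points. *)
Lemma band_resist x y :
  (h x - h y) ^+ 2 <= 3 * (2 * l%:R^-1 + n%:R / l%:R ^+ 3) * energy e h.
Proof.
apply: blocks_resist => i j iN jN.
apply: le_trans (path_resist _ iN jN) _.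
apply: (@le_trans _ _ (n%:R / l%:R * (energy e h / l%:R ^+ 2))); last first.
  by rewrite le_eqVlt; apply/orP; left; apply/eqP; field; rewrite gt_eqF.
apply: ler_pM => //; first exact: shift_energy_ge0.
  by rewrite ler_pdivlMr // -natrM ler_nat leq_divM.
by apply: block_energy => u v; exact: adjacent_blocks.
Qed.

Lemma block_grid_resist W x y : (0 < W)%N -> (2 * (W * W) <= N)%N ->
  (forall u v : 'I_n, (v %/ l = u %/ l + W)%N -> e u v) ->
  (h x - h y) ^+ 2 <= 3 * (2 * l%:R^-1 +
    (24 * harmonic_sum R W + 6 * (n%:R / (l%:R * W%:R ^+ 2))) / l%:R ^+ 2) * energy e h.
Proof.
move=> W0 WN eW; apply: blocks_resist => i j iN jN.
apply: le_trans (grid_resist W0 _ WN iN jN) _.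
have W0' : (0 : R) < W%:R by rewrite ltr0n.
have H0 : 0 <= harmonic_sum R W by apply: sumr_ge0 => k _; rewrite invr_ge0.
(* The factor [2] comes from the two shift energies, for shifts [1] and [W], each at most
   [energy e h / l ^ 2]. *)
apply: (@le_trans _ _ ((12 * harmonic_sum R W + 3 * (n%:R / (l%:R * W%:R ^+ 2))) *
   (2 * (energy e h / l%:R ^+ 2)))); last first.
  rewrite le_eqVlt; apply/orP; left; apply/eqP; field.
  by rewrite !gt_eqF.
apply: ler_pM.
- by rewrite addr_ge0 // !mulr_ge0 // invr_ge0 exprn_ge0.
- by rewrite /grid_energy addr_ge0 // shift_energy_ge0.
- rewrite lerD2l ler_pM2l ?ltr0n //.
  rewrite ler_pdivrMr ?exprn_gt0 //.
  have -> : n%:R / (l%:R * W%:R ^+ 2) * W%:R ^+ 2 = n%:R / l%:R :> R.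
    by field; rewrite !gt_eqF.
  by rewrite ler_pdivlMr // -natrM ler_nat leq_divM.
- rewrite mulr_natl mulr2n /grid_energy; apply: lerD; apply: block_energy => //.
  by move=> u v; exact: adjacent_blocks.
Qed.

End Energy.

Lemma ln2_ge_half (R : realType) : 2^-1 <= ln 2 :> R.
Proof.
have : ln (1 + - 2^-1) <= - 2^-1 :> R by apply: le_ln1Dx; lra.
have -> : 1 + - 2^-1 = 2^-1 :> R by lra.
by rewrite lnV ?posrE //; lra.
Qed.

(** * From resistance and distance to the ratio *)

Section Ratio.
Variables (R : realType) (n : nat) (e : rel 'I_n).
Hypothesis n2 : (2 <= n)%N.

Lemma ln_ge_half : 2^-1 <= ln n%:R :> R.
Proof.
apply: le_trans (ln2_ge_half R) _.
by rewrite ler_ln ?posrE ?ltr0n ?ler_nat //; lia.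
Qed.

(** As [ln 2 >= 1 / 2], the rounded logarithm is at most [2 * ln n + 1]; the remaining [3] is at
    most [6 * ln n]. *)
Lemma up_log_le_ln : (up_log 2 n)%:R + 2 <= 8 * ln n%:R :> R.
Proof.
have H := ln_ge_half.
have ln2 := ln2_ge_half R.
have /andP[lo _] := up_log_bounds (isT : 1 < 2)%N (n2 : 1 < n)%N.
have L1 : (0 < up_log 2 n)%N by rewrite up_log_gt0.
set L := up_log 2 n in lo L1 *.
have : ln ((2 ^ L.-1)%:R) <= ln n%:R :> R.
  by rewrite ler_ln ?posrE ?ltr0n ?expn_gt0 ?ler_nat //; [lia|exact: ltnW].
rewrite natrX lnXn // -[_ *+ L.-1]mulr_natr.
have -> : L%:R = L.-1%:R + 1 :> R by rewrite natr1 prednK.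
have : (0 : R) <= L.-1%:R by [].
set x := L.-1%:R => x0 hx. nra.
Qed.

Variables (rho : R) (Delta : nat) (g : 'I_n -> nat) (m : nat) (s u : 'I_n).
Hypothesis esym : symmetric e.
Hypothesis dpos : forall v, (0 < degree e v)%N.
Hypothesis dle : forall v, (degree e v <= Delta)%N.
Hypothesis rho0 : 0 <= rho.
Hypothesis resist : forall (h : 'I_n -> R) x y,
  (h x - h y) ^+ 2 <= rho * energy e h.
Hypothesis glip : forall v w, e v w -> (g w <= g v + m)%N.
Hypotheses (m0 : (0 < m)%N) (gs : g s = 0%N) (gu : (0 < g u)%N).

Lemma ratio_bound :
  (cover_broadcast_ratio R e <=
   ((4 * rho * n%:R * Delta%:R + 1) * (8 * ln n%:R) * (m%:R / (g u)%:R))%:E)%E.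
Proof.
set X := 4 * rho * n%:R * Delta%:R.
have X0 : 0 <= X by rewrite /X !mulr_ge0.
pose T := (Num.truncn X).+1.
have XT : X <= T%:R by apply: ltW; exact: truncnS_gt.
have TX : T%:R <= X + 1 by rewrite -natr1 lerD2r truncn_le.
have hc : (cover_time R e <= (T%:R * ((up_log 2 n)%:R + 2))%:E)%E.
  apply: (@cover_time_le R _ e esym dpos rho Delta) => //; rewrite ?card_ord //.
  exact: up_logP.
have gR : (0 : R) < (g u)%:R by rewrite ltr0n.
have mR : (0 : R) < m%:R by rewrite ltr0n.
have D0 : (0 : R) < (g u)%:R / m%:R by rewrite divr_gt0.
have hb := @broadcast_time_ge R _ e dpos g m glip s u m0 gs.
set B := broadcast_time R e in hb *.
have B0 : (0 < B)%E by apply: lt_le_trans hb; rewrite lte_fin.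
have iB : (0 <= B^-1)%E by rewrite inve_ge0 ltW.
have iB' : (B^-1 <= (m%:R / (g u)%:R)%:E)%E.
  have mg : (0 <= (m%:R / (g u)%:R : R)%:E)%E by rewrite lee_fin divr_ge0.
  rewrite inve_ple ?inE ?(ltW B0) //.
  by rewrite inver gt_eqF ?divr_gt0 // invf_div.
rewrite /cover_broadcast_ratio -/B.
apply: le_trans (lee_wpmul2r iB hc) _.
have T0 : (0 <= (T%:R * ((up_log 2 n)%:R + 2) : R)%:E)%E.
  by rewrite lee_fin mulr_ge0 // addr_ge0.
apply: le_trans (lee_wpmul2l T0 iB') _.
rewrite -EFinM lee_fin ler_pM2r ?divr_gt0 //.
by apply: ler_pM => //; rewrite ?addr_ge0 //; exact: up_log_le_ln.
Qed.

End Ratio.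

(** * Circulant graphs *)

Lemma nat_of_orb (x y : bool) : ~~ (x && y) -> (x || y : nat) = (x + y)%N.
Proof. by case: x; case: y. Qed.

Section Circulant.
Variable n : nat.

(** The representative of [y - x] modulo [n] below [n]. *)
Definition cdist (x y : 'I_n) : nat := (if x <= y then y - x else n + y - x)%N.

Definition circulant (P : pred nat) : rel 'I_n := fun x y => P (cdist x y).

Lemma degreeE (e : rel 'I_n) x : degree e x = (\sum_y e x y)%N.
Proof.
rewrite /degree /neighbors cardsE -sum1_card big_mkcond /=.
by apply: eq_bigr => y _; rewrite unfold_in; case: (e x y).
Qed.

Lemma cdist_lt (x y : 'I_n) : (cdist x y < n)%N.
Proof. by have := ltn_ord x; have := ltn_ord y; rewrite /cdist; case: (leqP x y); lia. Qed.

Lemma cdist_inj (x : 'I_n) : injective (fun y => Ordinal (cdist_lt x y)).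
Proof.
move=> y z /(congr1 val) /= H; apply: val_inj => /=; move: H.
have := ltn_ord x; have := ltn_ord y; have := ltn_ord z.
by rewrite /cdist; case: (leqP x y); case: (leqP x z); lia.
Qed.

Lemma degree_circulant (P : pred nat) x :
  degree (circulant P) x = (\sum_(z < n) P z)%N.
Proof.
by rewrite degreeE [RHS](reindex_inj (@cdist_inj x)).
Qed.

Lemma circulant_sym (P : pred nat) :
  (forall z, 0 < z < n -> P (n - z)%N = P z)%N -> symmetric (circulant P).
Proof.
move=> HP x y; have xn := ltn_ord x; have yn := ltn_ord y.
have [->|xy] := eqVneq x y; first by [].
have xy' : nat_of_ord x <> y by move=> E; case/eqP: xy; apply: val_inj.
rewrite /circulant -(HP (cdist x y)); last by rewrite /cdist; case: (leqP x y); lia.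
by congr P; rewrite /cdist; case: (leqP x y); case: (leqP y x); lia.
Qed.

Lemma circulant_irr (P : pred nat) : ~~ P 0%N -> irreflexive (circulant P).
Proof. by move=> P0 x; rewrite /circulant /cdist leqnn subnn; apply: negbTE. Qed.

Lemma sum_ord_eq c : (\sum_(y < n) (nat_of_ord y == c) = (c < n))%N.
Proof.
case: ltnP => h.
  rewrite (bigD1 (Ordinal h)) //= eqxx big1 // => y.
  by rewrite -val_eqE /= => /negbTE ->.
apply: big1 => y _; apply/eqP; rewrite eqb0; apply/eqP => E.
by have := ltn_ord y; rewrite E ltnNge h.
Qed.

Lemma degree_union (e e' : rel 'I_n) x : (forall y, ~~ (e x y && e' x y)) ->
  degree (fun x y => e x y || e' x y) x = (degree e x + degree e' x)%N.
Proof.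
move=> D; rewrite !degreeE -big_split; apply: eq_bigr => y _ /=.
by have := D y; case: (e x y); case: (e' x y).
Qed.

Definition link (i j : nat) : rel 'I_n := fun x y =>
  (nat_of_ord x == i) && (nat_of_ord y == j) ||
  (nat_of_ord x == j) && (nat_of_ord y == i).

Lemma degree_link i j x : (i < n)%N -> (j < n)%N -> i != j ->
  degree (link i j) x = ((nat_of_ord x == i) + (nat_of_ord x == j))%N.
Proof.
move=> ni nj ij; rewrite degreeE /link.
have [xi|xi] /= := eqVneq (nat_of_ord x) i.
  rewrite xi (negbTE ij) /= (eq_bigr (fun y : 'I_n => (nat_of_ord y == j) : nat)).
    by rewrite sum_ord_eq nj.
  by move=> y _; rewrite orbF.
have [xj|xj] /= := eqVneq (nat_of_ord x) j; last by rewrite big1.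
by rewrite sum_ord_eq ni.
Qed.

Lemma link_sym i j : symmetric (link i j).
Proof. by move=> x y; rewrite /link orbC ![(nat_of_ord y == _) && _]andbC. Qed.

End Circulant.

(** * The graphs of degree at least the square root of [n] *)

Lemma dense_ratio (R : realType) (kappa : R) (n d k : nat) (e : rel 'I_n)
    (g : 'I_n -> nat) (s t : 'I_n) :
  0 <= kappa -> (2 <= n)%N -> (0 < d)%N -> (0 < k)%N -> (k.*2 <= d)%N ->
  symmetric e -> regular e d ->
  (forall (h : 'I_n -> R) x y, (h x - h y) ^+ 2 <= kappa / d%:R * energy e h) ->
  (forall x y, e x y -> g y <= g x + k)%N -> g s = 0%N -> (n <= 8 * g t)%N ->
  (cover_broadcast_ratio R e <=
    ((4 * kappa + 1) * 32 * (d%:R * ln n%:R))%:E)%E.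
Proof.
move=> kappa0 n2 d0 k0 kd esym reg resist glip gs gt.
have dR : (0 : R) < d%:R by rewrite ltr0n.
have nR : (0 : R) < n%:R by rewrite ltr0n; lia.
have dpos x : (0 < degree e x)%N by rewrite reg.
have rho0 : 0 <= kappa / d%:R :> R by rewrite divr_ge0.
have dle x : (degree e x <= d)%N by rewrite reg.
have gt0 : (0 < g t)%N by lia.
apply: le_trans (@ratio_bound R n e n2 _ d g k s t esym dpos dle rho0 resist glip k0 gs gt0) _.
rewrite lee_fin.
have G0 : (0 : R) < (g t)%:R by rewrite ltr0n.
(* From [k <= d / 2] and [g t >= n / 8]; with the [8] of [ratio_bound] this makes the constant
   [32]. *)
have h1 : k%:R / (g t)%:R <= 4 * d%:R / n%:R :> R.
  rewrite ler_pdivrMr // mulrAC ler_pdivlMr // -!natrM ler_nat; nia.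
have ln0 : 0 <= ln n%:R :> R by apply: ln_ge0; rewrite ler1n; lia.
have n1 : (1 : R) <= n%:R by rewrite ler1n; lia.
have -> : 4 * (kappa / d%:R) * n%:R * d%:R = 4 * kappa * n%:R :> R.
  by field; rewrite gt_eqF.
apply: (@le_trans _ _ (((4 * kappa + 1) * n%:R) * (8 * ln n%:R) * (4 * d%:R / n%:R))); last first.
  by rewrite le_eqVlt; apply/orP; left; apply/eqP; field; rewrite gt_eqF.
apply: ler_pM => //.
  by rewrite !mulr_ge0 // addr_ge0 // !mulr_ge0 // ltW.
apply: ler_wpM2r; first by rewrite mulr_ge0.
by rewrite [X in _ <= X]mulrDl lerD2l mul1r.
Qed.

Lemma cycle_dist_lip (n k x y : nat) : (x <= y < n)%N ->
  (y - x <= k)%N || (n - k <= y - x)%N ->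
  (minn y (n - y) <= minn x (n - x) + k)%N /\
  (minn x (n - x) <= minn y (n - y) + k)%N.
Proof. by move=> /andP[xy yn] /orP[] h; split; lia. Qed.

(** The distance to [0] on the cycle of length [p] obtained from the one of length [2 * p] by
    identifying antipodal points, so that antipodal edges leave it unchanged. *)
Definition half_cycle_dist (p x : nat) : nat :=
  if (x < p)%N then minn x (p - x) else minn (x - p) (p.*2 - x).

Lemma half_cycle_dist_lip (p k x y : nat) : (x <= y < p.*2)%N ->
  [|| (y - x <= k)%N, (p.*2 - k <= y - x)%N | (y - x == p)%N] ->
  (half_cycle_dist p y <= half_cycle_dist p x + k)%N /\
  (half_cycle_dist p x <= half_cycle_dist p y + k)%N.
Proof.
move=> /andP[xy yp]; rewrite /half_cycle_dist => /or3P[] h.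
- by case: (ltnP x p) => xp; case: (ltnP y p) => yp'; split; lia.
- by case: (ltnP x p) => xp; case: (ltnP y p) => yp'; split; lia.
- by case: (ltnP x p) => xp; case: (ltnP y p) => yp'; split; lia.
Qed.

Lemma half_cycle_dist_half (p : nat) : (2 <= p)%N ->
  (p.*2 <= 8 * half_cycle_dist p p./2)%N.
Proof.
move=> p2; have := odd_double_half p; have := leq_b1 (odd p).
by rewrite /half_cycle_dist; case: ltnP; lia.
Qed.

Lemma dense_graph (R : realType) (n d : nat) :
  (n <= d * d)%N -> (d < n)%N -> ~~ odd (n * d) ->
  exists e : rel 'I_n,
    [/\ simple_connected_graph e, regular e d &
        (cover_broadcast_ratio R e <=
          ((4 * (81 * 5) + 1) * 32 * (d%:R * ln n%:R))%:E)%E].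
Proof.
move=> nd dn par; have d2 : (2 <= d)%N by nia.
pose k := d./2; pose p := n./2; pose o := odd d.
have dk : d = (o + k.*2)%N by rewrite odd_double_half.
(* For odd [d] the parity condition makes [n] even, so antipodal points exist. *)
have no : o -> n = (p.*2)%N.
  by move=> oo; move: par; rewrite oddM -/o oo andbT -{2}(odd_double_half n) => /negbTE ->.
have np : n = (odd n + p.*2)%N by rewrite odd_double_half.
have on := leq_b1 (odd n); have od := leq_b1 o.
have k1 : (1 <= k)%N by lia.
pose P : pred nat := fun z =>
  [|| (1 <= z < k.+1)%N, (n - k <= z < n)%N | o && (p <= z < p.+1)%N].
pose e := @circulant n P.
have esym : symmetric e.
  apply: circulant_sym => z /andP[z0 zn].
  have h1 : (1 <= n - z < k.+1)%N = (n - k <= z < n)%N.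
    by apply/andP/andP => -[h h']; split; lia.
  have h2 : (n - k <= n - z < n)%N = (1 <= z < k.+1)%N.
    by apply/andP/andP => -[h h']; split; lia.
  have h3 : o && (p <= n - z < p.+1)%N = o && (p <= z < p.+1)%N.
    by case: (o) no => //= H; apply/andP/andP => -[h h']; split; lia.
  by rewrite /P h1 h2 h3 orbCA.
have eirr : irreflexive e.
  apply: circulant_irr; apply/negP => /or3P[/andP[]|/andP[]|/and3P[oo]].
  - by [].
  - by lia.
  - by have := no oo; lia.
have reg : regular e d.
  move=> x; rewrite degree_circulant.
  rewrite (eq_bigr (fun z : 'I_n => (1 <= z < k.+1) + ((n - k <= z < n)
      + o * (p <= z < p.+1)))%N); last first.
    move=> z _; rewrite /P !nat_of_orb ?mulnb //.
      by apply/negP => /andP[/andP[h h'] /and3P[oo]]; have := no oo; lia.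
    apply/negP => /andP[/andP[h h'] /orP[/andP[]|/and3P[oo]]]; first by lia.
    by have := no oo; lia.
  by rewrite !big_split /= -big_distrr /= !sum_ord_itv; lia.
have l1 : (0 < uphalf k)%N by rewrite uphalf_half; lia.
(* The largest [l] with [2 * l - 1 <= k]: vertices of the same or of consecutive blocks are then
   adjacent. *)
pose l := uphalf k.
have lk : (k <= 2 * l)%N /\ (2 * l <= k.+1)%N.
  have := odd_double_half k; rewrite /l uphalf_half; have := leq_b1 (odd k); lia.
have l_le_n : (l <= n)%N by lia.
have band (x y : 'I_n) : x != y -> (y <= x + (2 * l).-1)%N ->
    (x <= y + (2 * l).-1)%N -> e x y.
  move=> xy; have xy' : nat_of_ord x <> y by move=> E; case/eqP: xy; apply: val_inj.
  have := ltn_ord x; have := ltn_ord y.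
  by rewrite /e /circulant /P /cdist; case: (leqP x y); lia.
have lR : (0 : R) < l%:R by rewrite ltr0n.
have dR : (0 : R) < d%:R by rewrite ltr0n; lia.
have nR : (0 : R) < n%:R by rewrite ltr0n; lia.
have resist (h : 'I_n -> R) x y : (h x - h y) ^+ 2 <= (81 * 5) / d%:R * energy e h.
  apply: le_trans (band_resist _ l1 l_le_n band x y) _.
  apply: ler_wpM2r; first exact: energy_ge0.
  (* Since [d <= 2 * k + 1 <= 5 * l], one has [n <= d ^ 2 <= 25 * l ^ 2]; the total is
     [3 * (2 + 25) = 81] times [1 / l]. *)
  have h1 : n%:R / l%:R ^+ 3 <= 25 / l%:R :> R.
    rewrite ler_pdivrMr ?exprn_gt0 //.
    have -> : 25 / l%:R * l%:R ^+ 3 = 25 * l%:R ^+ 2 :> R by field; rewrite gt_eqF.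
    by rewrite -natrX -natrM ler_nat -mulnn; nia.
  have h2 : l%:R^-1 <= 5 / d%:R :> R.
    by rewrite ler_pdivlMr // ler_pdivrMl // -natrM ler_nat; lia.
  rewrite -mulrA.
  move: h1 h2; rewrite [25 / _]mulrC; set a := l%:R^-1; set b := 5 / _; set c := n%:R / _.
  by move=> h1 h2; lra.
have n2 : (2 <= n)%N by lia.
(* The matching edges change the cycle distance by too much, so for odd [d] antipodal points are
   identified. *)
pose g (x : 'I_n) : nat := if o then half_cycle_dist p x else minn x (n - x).
have edge x y : e x y -> let z := (maxn x y - minn x y)%N in
    [|| (z <= k)%N, (n - k <= z)%N | o && (z == p)].
  have xn := ltn_ord x; have yn := ltn_ord y; rewrite /e /circulant /cdist /=.
  case: (leqP x y) => xy /or3P[/andP[h h']|/andP[h h']|/and3P[oo h h']].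
  - by apply/or3P; apply: Or31; lia.
  - by apply/or3P; apply: Or32; lia.
  - by apply/or3P; apply: Or33; rewrite oo; lia.
  - by apply/or3P; apply: Or32; lia.
  - by apply/or3P; apply: Or31; lia.
  - by apply/or3P; apply: Or33; rewrite oo; have := no oo; lia.
have glip x y : e x y -> (g y <= g x + k)%N.
  move=> /edge /=; rewrite /g; have xn := ltn_ord x; have yn := ltn_ord y.
  case: (boolP o) => oo.
    have -> : (n - k = p.*2 - k)%N by have := no oo; lia.
    rewrite /= => h; case: (leqP x y) h => xy h.
      by have [] := @half_cycle_dist_lip p k x y _ h; rewrite // xy -(no oo).
    by have [] := @half_cycle_dist_lip p k y x _ h; rewrite // ltnW //= -(no oo).
  rewrite orbF; case: (leqP x y) => xy h.
    by have [] := @cycle_dist_lip n k x y _ h; rewrite // xy.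
  by have [] := @cycle_dist_lip n k y x _ h; rewrite // ltnW.
pose t := if o then p./2 else p.
have tn : (t < n)%N by rewrite /t; case: (o); lia.
have n0 : (0 < n)%N by lia.
pose s0 := Ordinal n0; pose t0 := Ordinal tn.
have gs : g s0 = 0%N.
  by rewrite /g /half_cycle_dist /= !min0n; case: (o) => //; case: ifP => //; lia.
have gt : (n <= 8 * g t0)%N.
  rewrite /g /t0 /= /t; case: (boolP o) => oo; last by clear -np on n2; lia.
  by rewrite {1}(no oo); apply: half_cycle_dist_half; have := no oo; clear -nd dn d2; nia.
have kd : (k.*2 <= d)%N by lia.
have d0 : (0 < d)%N by lia.
have kappa0 : 0 <= 81 * 5 :> R by rewrite mulr_ge0.
exists e; split => //.
  by split => // x y; exact: (resist_connected esym resist).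
exact: (dense_ratio kappa0 n2 d0 k1 kd esym reg resist glip gs gt).
Qed.

(** * The sparse case *)

Lemma exists_nat_sqrt n : exists r, (r * r <= n < r.+1 * r.+1)%N.
Proof.
elim: n => [|n [r /andP[lo hi]]]; first by exists 0%N.
by case: (ltnP n.+1 (r.+1 * r.+1)) => h; [exists r | exists r.+1]; apply/andP; split; nia.
Qed.

Lemma min_max_degreeI (n d : nat) (e : rel 'I_n) s t :
  (forall x, d <= degree e x <= d.+1)%N -> degree e s = d -> degree e t = d.+1 ->
  min_degree e d /\ max_degree e d.+1.
Proof.
move=> H es et; split; split.
- by exists s.
- by move=> v; have /andP[] := H v.
- by exists t.
- by move=> v; have /andP[] := H v.
Qed.

Lemma sparse_ratio (R : realType) (kappa : R) (n d r m : nat) (e : rel 'I_n) :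
  0 <= kappa -> (4 <= n)%N -> (2 <= d)%N -> (r * r <= n)%N -> (0 < m <= 2 * r)%N ->
  symmetric e -> (forall x, d <= degree e x <= d.+1)%N ->
  (forall (h : 'I_n -> R) x y,
     (h x - h y) ^+ 2 <= kappa * ln n%:R / d%:R * energy e h) ->
  (forall x y : 'I_n, e x y -> minn y (n - y) <= minn x (n - x) + m)%N ->
  (cover_broadcast_ratio R e <=
    ((6 * kappa + 2) * 48 * (Num.sqrt n%:R * ln n%:R ^+ 2))%:E)%E.
Proof.
move=> kappa0 n4 d2 rn /andP[m0 mr] esym deg resist glip.
have n2 : (2 <= n)%N by lia.
have lnh := ln_ge_half R n2; have ln0 : (0 : R) <= ln n%:R by lra.
have dR : (0 : R) < d%:R by rewrite ltr0n; lia.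
have nR : (0 : R) < n%:R by rewrite ltr0n; lia.
have rho0 : 0 <= kappa * ln n%:R / d%:R by rewrite divr_ge0 // mulr_ge0.
have dpos x : (0 < degree e x)%N by have /andP[] := deg x; lia.
have dle x : (degree e x <= d.+1)%N by have /andP[] := deg x.
have n0 : (0 < n)%N by lia.
have tn : (n./2 < n)%N by have := odd_double_half n; lia.
pose g (x : 'I_n) := minn x (n - x).
pose s0 := Ordinal n0; pose t0 := Ordinal tn.
have gs : g s0 = 0%N by rewrite /g /=; lia.
have gt : (n <= 3 * g t0)%N.
  by rewrite /g /t0 /=; have := odd_double_half n; have := leq_b1 (odd n); lia.
have gt0 : (0 < g t0)%N by lia.
apply: le_trans (@ratio_bound R n e n2 _ d.+1 g m s0 t0 esym dpos dle rho0 resist glip m0 gs gt0) _.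
rewrite lee_fin.
have G0 : (0 : R) < (g t0)%:R by rewrite ltr0n.
have rs : r%:R <= Num.sqrt n%:R :> R.
  by rewrite -(@ler_pXn2r _ 2) ?nnegrE ?sqrtr_ge0 // sqr_sqrtr // -natrX ler_nat -mulnn.
(* From [m <= 2 * r], [r <= sqrt n] and [g t0 >= n / 3]; with the [8] of [ratio_bound] this makes
   the constant [48]. *)
have h1 : m%:R / (g t0)%:R <= 6 * Num.sqrt n%:R / n%:R :> R.
  apply: (@le_trans _ _ (6 * r%:R / n%:R)).
    by rewrite ler_pdivrMr // mulrAC ler_pdivlMr // -!natrM ler_nat; nia.
  by rewrite ler_pM2r ?invr_gt0 // ler_pM2l.
set L := ln n%:R in lnh ln0 rho0 resist *; set S := Num.sqrt n%:R in rs h1 *.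
have S0 : 0 <= S by exact: sqrtr_ge0.
apply: (@le_trans _ _ (((6 * kappa + 2) * L * n%:R) * (8 * L) * (6 * S / n%:R))); last first.
  by rewrite le_eqVlt; apply/orP; left; apply/eqP; field; rewrite gt_eqF.
have d32 : d.+1%:R / d%:R <= 3 / 2 :> R.
  have : (2 : R) <= d%:R by rewrite ler_nat.
  by rewrite ler_pdivrMr // -[d.+1%:R]natr1; lra.
apply: ler_pM => //.
  by rewrite !mulr_ge0 // addr_ge0 // !mulr_ge0 // invr_ge0 ltW.
apply: ler_wpM2r; first by rewrite mulr_ge0.
have -> : 4 * (kappa * L / d%:R) * n%:R * d.+1%:R =
  4 * (kappa * L * n%:R) * (d.+1%:R / d%:R) by ring.
have kLn : 0 <= kappa * L * n%:R by rewrite !mulr_ge0 // ltW.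
have h2 := ler_wpM2l kLn d32.
have n1 : (1 : R) <= n%:R by rewrite ler1n.
(* This absorbs the additive [1] of [ratio_bound] into the [+ 2] of the constant. *)
have h3 : 1 <= 2 * L * n%:R by nra.
move: h2 h3; set a := kappa * L * n%:R; set b := _ / _ => h2 h3.
have -> : (6 * kappa + 2) * L * n%:R = 6 * a + 2 * L * n%:R by rewrite /a; ring.
lra.
Qed.

Lemma log_resist (R : realType) (n l W r d : nat) (e : rel 'I_n) :
  (9 <= n)%N -> (r * r <= n < r.+1 * r.+1)%N -> (0 < l)%N -> (0 < W)%N ->
  (2 * (W * l * (W * l)) <= n)%N -> (3 * r.+1 <= 8 * (W * l))%N ->
  (0 < d <= 10 * l)%N ->
  (forall x y : 'I_n, x != y -> (y <= x + (2 * l).-1)%N ->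
     (x <= y + (2 * l).-1)%N -> e x y) ->
  (forall x y : 'I_n, (y < x + W * l + l)%N -> (x + W * l < y + l)%N -> e x y) ->
  forall (h : 'I_n -> R) x y,
    (h x - h y) ^+ 2 <= 72 * 72 * ln n%:R / d%:R * energy e h.
Proof.
move=> n9 /andP[rn nr] l0 W0 WN Wr /andP[d0 dl] band far h x y.
have l_le_n : (l <= n)%N by nia.
have WN' : (2 * (W * W) <= n %/ l)%N by rewrite leq_divRL //; nia.
have far' (u v : 'I_n) : (v %/ l = u %/ l + W)%N -> e u v.
  have eu := divn_eq u l; have mu := ltn_pmod u l0.
  have ev := divn_eq v l; have mv := ltn_pmod v l0.
  move=> E; rewrite E mulnDl in ev; apply: far; move: eu ev.
    by set p := (u %/ l * l)%N; lia.
  by set p := (u %/ l * l)%N; lia.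
apply: le_trans (block_grid_resist _ l0 l_le_n band x y W0 WN' far') _.
apply: ler_wpM2r; first exact: energy_ge0.
have lR : (0 : R) < l%:R by rewrite ltr0n.
have WR : (0 : R) < W%:R by rewrite ltr0n.
have dR : (0 : R) < d%:R by rewrite ltr0n.
have n2 : (2 <= n)%N by lia.
have lnh := ln_ge_half R n2.
have HW : harmonic_sum R W <= 1 + ln n%:R.
  apply: le_trans (harmonic_sum_le R W0) _; rewrite lerD2l ler_ln ?posrE ?ltr0n //; last by lia.
  by rewrite ler_nat; nia.
(* From [3 * r.+1 <= 8 * (W * l)] one gets [n < r.+1 ^ 2 <= 64 / 9 * (W * l) ^ 2]. *)
have h1 : n%:R / (l%:R * W%:R ^+ 2) / l%:R ^+ 2 <= 8 / l%:R :> R.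
  rewrite ler_pdivrMr ?exprn_gt0 // ler_pdivrMr ?mulr_gt0 ?exprn_gt0 //.
  have -> : 8 / l%:R * l%:R ^+ 2 * (l%:R * W%:R ^+ 2) = 8 * (W%:R * l%:R * (W%:R * l%:R)) :> R.
    by field; rewrite gt_eqF.
  by rewrite -!natrM ler_nat; nia.
have h2 : (l%:R ^+ 2)^-1 <= l%:R^-1 :> R.
  by rewrite lef_pV2 ?posrE ?exprn_gt0 // -natrX ler_nat -mulnn leq_pmulr.
have h3 : l%:R^-1 <= 10 / d%:R :> R.
  by rewrite ler_pdivlMr // ler_pdivrMl // -natrM ler_nat; lia.
have H0 : 0 <= harmonic_sum R W by apply: sumr_ge0 => k _; rewrite invr_ge0.
have il : 0 < l%:R^-1 :> R by rewrite invr_gt0.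
have h4 : harmonic_sum R W / l%:R ^+ 2 <= (3 * ln n%:R) * l%:R^-1.
  by apply: ler_pM; rewrite ?invr_ge0 ?exprn_ge0 //; lra.
have -> : 3 * (2 / l%:R + (24 * harmonic_sum R W + 6 * (n%:R / (l%:R * W%:R ^+ 2))) / l%:R ^+ 2)
  = 6 * l%:R^-1 + 72 * (harmonic_sum R W / l%:R ^+ 2)
    + 18 * (n%:R / (l%:R * W%:R ^+ 2) / l%:R ^+ 2) by ring.
(* [516 = 2 * (6 + 18 * 8) + 72 * 3], using [1 <= 2 * ln n] on the first group. With
   [1 / l <= 10 / d] this gives [5160], below [72 * 72]. *)
apply: (@le_trans _ _ (516 * ln n%:R * l%:R^-1)).
  have h5 : 2^-1 * l%:R^-1 <= ln n%:R * l%:R^-1 :> R by rewrite (ler_pM2r il).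
  move: h1 h4 h5; set p := _ / l%:R ^+ 2; set q := harmonic_sum R W / _.
  by set v := l%:R^-1; set L := ln n%:R => h1 h4 h5; nra.
apply: (@le_trans _ _ (516 * ln n%:R * (10 / d%:R))).
  by apply: ler_wpM2l h3; apply: mulr_ge0; [exact: ler0n | lra].
have : 0 <= ln n%:R / d%:R :> R by rewrite divr_ge0 //; lra.
set z := ln n%:R / d%:R => z0.
have -> : 516 * ln n%:R * (10 / d%:R) = (516 * 10) * z by rewrite /z; ring.
have -> : 72 * 72 * ln n%:R / d%:R = (72 * 72) * z by rewrite /z; ring.
by apply: ler_wpM2r => //; lra.
Qed.

Definition sparse_bound (R : realType) (n d : nat) : Prop :=
  exists e : rel 'I_n,
    [/\ simple_connected_graph e, min_degree e d, max_degree e d.+1 &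
        (cover_broadcast_ratio R e <=
          ((6 * (72 * 72) + 2) * 48 * (Num.sqrt n%:R * ln n%:R ^+ 2))%:E)%E].

Lemma sparse_boundI (R : realType) (n d r m : nat) (e : rel 'I_n) (s t : 'I_n) :
  (4 <= n)%N -> (2 <= d)%N -> (r * r <= n)%N -> (0 < m <= 2 * r)%N ->
  symmetric e -> irreflexive e -> (forall x, d <= degree e x <= d.+1)%N ->
  degree e s = d -> degree e t = d.+1 ->
  (forall (h : 'I_n -> R) x y,
     (h x - h y) ^+ 2 <= 72 * 72 * ln n%:R / d%:R * energy e h) ->
  (forall x y : 'I_n, e x y -> minn y (n - y) <= minn x (n - x) + m)%N ->
  sparse_bound R n d.
Proof.
move=> n4 d2 rn mr esym eirr deg ds dt resist glip.
have [mind maxd] := min_max_degreeI deg ds dt.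
have kappa0 : 0 <= 72 * 72 :> R by apply: mulr_ge0; exact: ler0n.
exists e; split => //.
  by split => // x y; exact: (resist_connected esym resist).
exact: (sparse_ratio kappa0 n4 d2 rn mr esym deg resist glip).
Qed.

Section Bands.
Variables (n a b c : nat).
Hypotheses (a0 : (0 < a)%N) (ab : (a <= b)%N) (bc : (b <= c)%N) (cn : (2 * c <= n)%N).

(** Differences from [1] to [a - 1] and from [b] to [c - 1], together with their opposites modulo
    [n]. *)
Definition bands : pred nat := fun z =>
  [|| (1 <= z < a)%N, (b <= z < c)%N, (n.+1 - c <= z < n.+1 - b)%N
    | (n.+1 - a <= z < n)%N].

Lemma bands_opp z : (0 < z < n)%N -> bands (n - z)%N = bands z.
Proof.
move=> /andP[z0 zn].
have h1 : (1 <= n - z < a)%N = (n.+1 - a <= z < n)%N.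
  by apply/andP/andP => -[h h']; split; lia.
have h2 : (b <= n - z < c)%N = (n.+1 - c <= z < n.+1 - b)%N.
  by apply/andP/andP => -[h h']; split; lia.
have h3 : (n.+1 - c <= n - z < n.+1 - b)%N = (b <= z < c)%N.
  by apply/andP/andP => -[h h']; split; lia.
have h4 : (n.+1 - a <= n - z < n)%N = (1 <= z < a)%N.
  by apply/andP/andP => -[h h']; split; lia.
rewrite /bands h1 h2 h3 h4; apply/or4P/or4P => -[] h;
  by [apply: Or41|apply: Or42|apply: Or43|apply: Or44].
Qed.

Lemma bands_sym : symmetric (@circulant n bands).
Proof. exact: circulant_sym bands_opp. Qed.

Lemma bands_irr : irreflexive (@circulant n bands).
Proof. by apply: circulant_irr; apply/negP => /or4P[] /andP[]; lia. Qed.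

Lemma degree_bands x : degree (@circulant n bands) x = (2 * (a.-1 + (c - b)))%N.
Proof.
rewrite degree_circulant.
rewrite (eq_bigr (fun z : 'I_n => (1 <= z < a) + ((b <= z < c) +
  ((n.+1 - c <= z < n.+1 - b) + (n.+1 - a <= z < n))))%N); last first.
  move=> z _; rewrite /bands !nat_of_orb //; apply/negP => /andP[/andP[h h']].
  - by move=> /andP[]; lia.
  - by move=> /orP[] /andP[]; lia.
  - by move=> /or3P[] /andP[]; lia.
rewrite !big_split /= !sum_ord_itv; try lia.
Qed.

Lemma bands_lip (x y : 'I_n) :
  circulant bands x y -> (minn y (n - y) <= minn x (n - x) + c)%N.
Proof.
have := ltn_ord x; have := ltn_ord y; rewrite /circulant /cdist.
by case: (leqP x y) => xy yn xn /or4P[] /andP[h h']; lia.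
Qed.

End Bands.

(** * The graphs of degree between three and the square root of [n] *)

Section SparseGraph.
Variables (n d r : nat).
Hypotheses (d3 : (3 <= d)%N) (dr : (d <= r)%N).
Hypotheses (rn : (r * r <= n)%N) (nr : (n < r.+1 * r.+1)%N).

(** The circulant graph has [k] positive differences: [2 * l - 1] of them centred at [q], which join
    blocks at distance [W] completely, and the [k + 1 - 2 * l] smallest ones. As [4 * l <= k + 2],
    the latter reach [2 * l - 1]. [W] makes [q] close to [r / 2]. *)
Let k := uphalf d.
Let l := ((k + 2) %/ 4)%N.
Let W := (uphalf r %/ l)%N.
Let q := (W * l)%N.

Lemma sparse_parameters :
  [/\ (d <= k.*2 <= d.+1)%N, (4 * l <= k + 2 < 4 * l + 4)%N, (0 < l)%N,
      (2 * q <= r.+1)%N & (r + 2 <= 2 * (q + l))%N].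
Proof.
have dk : (d <= k.*2 <= d.+1)%N.
  by rewrite /k uphalf_half; have := odd_double_half d; have := leq_b1 (odd d); lia.
have l4 := divn_eq (k + 2) 4; have m4 := ltn_pmod (k + 2) (isT : 0 < 4)%N.
have l0 : (0 < l)%N by rewrite /l divn_gt0 //; lia.
have W1 := divn_eq (uphalf r) l; have mW := ltn_pmod (uphalf r) l0.
have hr : (r <= (uphalf r).*2 <= r.+1)%N.
  by rewrite uphalf_half; have := odd_double_half r; have := leq_b1 (odd r); lia.
rewrite -/l in l4; rewrite -/W -/q in W1.
by split; lia.
Qed.

Let P := bands n (k + 2 - 2 * l)%N (q + 1 - l)%N (q + l)%N.

Lemma sparse_inequalities :
  [/\ (2 * (q + l) <= n)%N, (q + l <= 2 * r)%N, (2 * (q * q) <= n)%N,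
      (3 * r.+1 <= 8 * q)%N & (k + 1 - 2 * l < q + 1 - l)%N].
Proof.
have [dk kl l0 q1 q2] := sparse_parameters.
have r3 : (3 <= r)%N by lia.
have l8 : (8 * l <= r + 5)%N by lia.
have q8 : (3 * r.+1 <= 8 * q)%N by lia.
by split; try lia; nia.
Qed.

Lemma sparse_W_gt0 : (0 < W)%N.
Proof. by have [_ _ _ q8 _] := sparse_inequalities; case: (W) @q q8 => //= q; rewrite /q; lia. Qed.

Lemma sparse_l_le_q : (l <= q)%N.
Proof. by rewrite /q leq_pmull // sparse_W_gt0. Qed.

Lemma sparse_bands : [/\ (0 < k + 2 - 2 * l)%N, (k + 2 - 2 * l <= q + 1 - l)%N,
  (q + 1 - l <= q + l)%N & (2 * (q + l) <= n)%N].
Proof.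
have [dk kl l0 q1 q2] := sparse_parameters.
by have [i1 i2 i3 i4 i5] := sparse_inequalities; split; lia.
Qed.

Lemma sparse_sym : symmetric (@circulant n P).
Proof. by have [h1 h2 h3 h4] := sparse_bands; exact: bands_sym. Qed.

Lemma sparse_irr : irreflexive (@circulant n P).
Proof. by have [h1 h2 h3 h4] := sparse_bands; exact: bands_irr. Qed.

Lemma sparse_degree x : degree (@circulant n P) x = k.*2.
Proof.
have [dk kl l0 q1 q2] := sparse_parameters; have lq := sparse_l_le_q.
by have [h1 h2 h3 h4] := sparse_bands; rewrite degree_bands //; lia.
Qed.

Lemma sparse_lip (x y : 'I_n) :
  circulant P x y -> (minn y (n - y) <= minn x (n - x) + (q + l))%N.
Proof. by have [h1 h2 h3 h4] := sparse_bands; exact: bands_lip. Qed.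

Lemma sparse_band (x y : 'I_n) : x != y -> (y <= x + (2 * l).-1)%N ->
  (x <= y + (2 * l).-1)%N -> circulant P x y.
Proof.
have [dk kl l0 q1 q2] := sparse_parameters.
have [i1 i2 i3 i4 i5] := sparse_inequalities; have lq := sparse_l_le_q.
move=> xy; have xy' : nat_of_ord x <> y by move=> E; case/eqP: xy; apply: val_inj.
have := ltn_ord x; have := ltn_ord y.
rewrite /circulant /cdist; case: (leqP x y) => h yn xn h1 h2; apply/or4P.
  by apply: Or41; lia.
by apply: Or44; lia.
Qed.

Lemma sparse_far (x y : 'I_n) : (y < x + q + l)%N -> (x + q < y + l)%N ->
  circulant P x y.
Proof.
have [dk kl l0 q1 q2] := sparse_parameters.
have [i1 i2 i3 i4 i5] := sparse_inequalities; have lq := sparse_l_le_q.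
have := ltn_ord x; have := ltn_ord y.
rewrite /circulant /cdist => yn xn h1 h2; rewrite ifT; last by lia.
by apply/or4P; apply: Or42; lia.
Qed.

(** The block argument never uses the edge between [0] and [n - 1], so that edge may be missing from
    [e]. *)
Lemma sparse_resist (R : realType) (e : rel 'I_n) :
  (forall x y : 'I_n, circulant P x y -> (x < y + (n - 1))%N ->
     (y < x + (n - 1))%N -> e x y) ->
  forall (h : 'I_n -> R) x y,
    (h x - h y) ^+ 2 <= 72 * 72 * ln n%:R / d%:R * energy e h.
Proof.
have [dk kl l0 q1 q2] := sparse_parameters.
have [i1 i2 i3 i4 i5] := sparse_inequalities; have lq := sparse_l_le_q.
move=> sub; apply: (@log_resist R n l W r d e) => //.
- by nia.
- by rewrite rn.
- exact: sparse_W_gt0.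
- by lia.
- by move=> x y xy h1 h2; apply: sub; [exact: sparse_band | lia | lia].
- move=> x y; rewrite -/q => h1 h2.
  by apply: sub; [exact: sparse_far | lia | lia].
Qed.

Lemma sparse_graph (R : realType) : sparse_bound R n d.
Proof.
have [dk kl l0 q1 q2] := sparse_parameters.
have [i1 i2 i3 i4 i5] := sparse_inequalities; have lq := sparse_l_le_q.
have n9 : (9 <= n)%N by nia.
have n0 : (0 < n)%N by lia.
have n1 : (1 < n)%N by lia.
have mr : (0 < q + l <= 2 * r)%N by lia.
pose c := @circulant n P.
have [ev|od] : k.*2 = d \/ k.*2 = d.+1 by lia.
  (* For even [d] the circulant graph is [d]-regular. The added edge has the first difference above
     the long band, so it is new and keeps the Lipschitz constant [q + l]. *)
  pose e : rel 'I_n := fun x y => c x y || link 0 (q + l) x y.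
  have dis x y : ~~ (c x y && link 0 (q + l) x y).
    apply/negP => /andP[]; rewrite /link => cxy /orP[] /andP[/eqP hx /eqP hy].
      by move: cxy; rewrite /c /circulant /cdist hx hy leq0n => /or4P[] /andP[]; lia.
    move: cxy; rewrite /c /circulant /cdist hx hy ifF; last by lia.
    by move=> /or4P[] /andP[]; lia.
  have deg x : degree e x = (d + ((nat_of_ord x == 0) + (nat_of_ord x == q + l)))%N.
    by rewrite degree_union // sparse_degree ev degree_link //; lia.
  apply: (@sparse_boundI R n d r (q + l) e (Ordinal n1) (Ordinal n0)) => //.
  - by lia.
  - by lia.
  - by move=> x y; rewrite /e /c sparse_sym link_sym.
  - by move=> x; rewrite /e /c sparse_irr /link; apply/negbTE; lia.
  - by move=> x; rewrite deg; lia.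
  - by rewrite deg /=; lia.
  - by rewrite deg /=; lia.
  - by apply: sparse_resist => x y cxy _ _; rewrite /e /c cxy.
  - by move=> x y /orP[/sparse_lip //|]; rewrite /link; lia.
(* For odd [d] the circulant graph is [d.+1]-regular, and one deleted edge lowers two degrees to
   [d]. *)
pose e : rel 'I_n := fun x y => c x y && ~~ link 0 n.-1 x y.
have deg x : (degree e x + ((nat_of_ord x == 0) + (nat_of_ord x == n.-1)))%N = d.+1.
  rewrite -od -(sparse_degree x) -degree_link; [|lia..].
  rewrite -degree_union; last first.
    by move=> y; rewrite /e; case: (c x y); case: (link _ _ _ _).
  rewrite !degreeE; apply: eq_bigr => y _; rewrite /e.
  case E: (link _ _ _ _); last by rewrite andbT orbF.
  rewrite andbF orFb; congr nat_of_bool; apply/esym.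
  move: E; rewrite /link /c /circulant /cdist => /orP[] /andP[/eqP -> /eqP ->].
    by rewrite leq0n; apply/or4P; apply: Or44; lia.
  by rewrite ifF; last lia; apply/or4P; apply: Or41; lia.
apply: (@sparse_boundI R n d r (q + l) e (Ordinal n0) (Ordinal n1)) => //.
- by lia.
- by lia.
- by move=> x y; rewrite /e /c sparse_sym link_sym.
- by move=> x; rewrite /e /c sparse_irr.
- by move=> x; have := deg x; lia.
- by have := deg (Ordinal n0); rewrite /=; lia.
- by have := deg (Ordinal n1); rewrite /=; lia.
- apply: sparse_resist => x y cxy h1 h2; rewrite /e /c cxy /link /=.
  have := ltn_ord x; have := ltn_ord y; lia.
- by move=> x y /andP[/sparse_lip].
Qed.

End SparseGraph.

(** * The case of degree two *)

Lemma edge_energy (R : realType) (n : nat) (e : rel 'I_n) (h : 'I_n -> R) u v :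
  e u v -> (h u - h v) ^+ 2 <= energy e h.
Proof.
move=> uv; apply: le_trans (energy_row e h u).
by rewrite (bigD1 v) //= lerDl; apply: sumr_ge0 => w _; exact: sqr_ge0.
Qed.

Lemma sqr_add_le2 (R : realType) (x y : R) : (x + y) ^+ 2 <= 2 * (x ^+ 2 + y ^+ 2).
Proof. by have := sqr_ge0 (x - y); rewrite !expr2; nra. Qed.

Lemma two_edges_energy (R : realType) (n : nat) (e : rel 'I_n) (h : 'I_n -> R)
    (M : nat) (phi psi chi : nat -> 'I_n) : symmetric e ->
  (forall i j, (i < M)%N -> (j < M)%N -> phi i = phi j -> i = j) ->
  (forall i j, (i < M)%N -> (j < M)%N -> chi i = chi j -> i = j) ->
  (forall i, (i < M)%N -> e (phi i) (psi i) && e (psi i) (chi i)) ->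
  \sum_(0 <= i < M) (h (phi i) - h (chi i)) ^+ 2 <= 4 * energy e h.
Proof.
move=> esym ip ic ed.
have h1 : \sum_(0 <= i < M) (h (phi i) - h (psi i)) ^+ 2 <= energy e h.
  by apply: edges_energy => // i /ed /andP[].
have h2 : \sum_(0 <= i < M) (h (chi i) - h (psi i)) ^+ 2 <= energy e h.
  by apply: edges_energy => // i /ed /andP[_]; rewrite esym.
apply: (@le_trans _ _ (2 * (\sum_(0 <= i < M) (h (phi i) - h (psi i)) ^+ 2 +
    \sum_(0 <= i < M) (h (chi i) - h (psi i)) ^+ 2))); last by lra.
rewrite -big_split mulr_sumr /=; apply: ler_sum => i _.
have -> : h (phi i) - h (chi i) = (h (phi i) - h (psi i)) + (h (psi i) - h (chi i)).
  ring.
apply: le_trans (sqr_add_le2 _ _) _.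
by rewrite -[X in _ + X]sqrrN opprB.
Qed.

Section Brickwork.
Variables (n r : nat).
Hypotheses (n5 : (5 <= n)%N) (rn : (r * r <= n)%N) (nr : (n < r.+1 * r.+1)%N).

Let W := r./2.
Let w := (W.*2).+1.
Let P : pred nat := fun z => (1 <= z < 2)%N || (n - 1 <= z < n)%N.

(* The cycle together with the chords joining an even [x] to [x + w]; contracting
   the edges [2 i, 2 i + 1] turns it into a grid of width [W]. *)
Let chord : rel 'I_n := fun x y =>
  ~~ odd x && (nat_of_ord y == x + w)%N || ~~ odd y && (nat_of_ord x == y + w)%N.
Let e : rel 'I_n := fun x y => circulant P x y || chord x y.

Lemma brick_parameters :
  [/\ (2 <= r)%N, (0 < W)%N, (W.*2 <= r <= W.*2.+1)%N & (w < n - 1)%N].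
Proof.
have r2 : (2 <= r)%N by nia.
have hr : (W.*2 <= r <= W.*2.+1)%N.
  by rewrite /W; have := odd_double_half r; have := leq_b1 (odd r); lia.
have : (w <= r.+1)%N by rewrite /w; lia.
by split; [lia | lia | lia | nia].
Qed.

Lemma brick_width : [/\ (W <= n)%N, (2 * (W * W) <= n./2)%N & (n./2 <= 8 * (W * W))%N].
Proof.
have [r2 W0 hr _] := brick_parameters.
have hN : (n./2.*2 <= n <= n./2.*2.+1)%N.
  by have := odd_double_half n; have := leq_b1 (odd n); lia.
by split; nia.
Qed.

Lemma brick_sym : symmetric e.
Proof.
move=> x y; rewrite /e circulant_sym; first by rewrite /chord [X in _ || X = _]orbC.
by move=> z zn; rewrite /P; apply/idP/idP; lia.
Qed.

Lemma brick_irr : irreflexive e.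
Proof.
have [r2 W0 hr wn] := brick_parameters.
move=> x; rewrite /e circulant_irr /chord; last by rewrite /P; lia.
by apply/negbTE; rewrite /w; lia.
Qed.

(** As [w] is odd, chords go from even vertices up to odd ones, so each vertex has at most one. *)
Lemma degree_chord x : degree chord x =
  if odd x then (w <= x)%N : nat else (x + w < n)%N : nat.
Proof.
rewrite degreeE /chord; case: ifPn => ox /=; last first.
  rewrite -sum_ord_eq; apply: eq_bigr => y _; congr nat_of_bool.
  case: eqP => //= yx; apply/negbTE; apply/negP => /andP[oy /eqP xy].
  by move: ox; rewrite xy oddD (negbTE oy) /w /= odd_double.
case: (leqP w x) => wx; last first.
  apply: big1 => y _; apply/eqP; rewrite eqb0; apply/negP => /andP[_ /eqP]; lia.
have xn : (x - w < n)%N by have := ltn_ord x; lia.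
transitivity (\sum_(y < n) (nat_of_ord y == x - w))%N; last by rewrite sum_ord_eq xn.
apply: eq_bigr => y _; congr nat_of_bool.
apply/andP/eqP => [[_ /eqP]|yx]; first by lia.
split; last by rewrite yx; apply/eqP; lia.
by rewrite yx oddB // ox /w /= odd_double.
Qed.

Lemma brick_degree x : degree e x = (2 + degree chord x)%N.
Proof.
have [r2 W0 hr wn] := brick_parameters.
rewrite degree_union => [|y].
  rewrite degree_circulant; congr addn.
  rewrite (eq_bigr (fun z : 'I_n => (1 <= z < 2) + (n - 1 <= z < n))%N); last first.
    by move=> z _; rewrite /P; case E1: (1 <= z < 2)%N; case E2: (n - 1 <= z < n)%N => //; lia.
  by rewrite big_split /= !sum_ord_itv; lia.
apply/negP => /andP[]; rewrite /circulant /cdist /P /chord /w.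
have := ltn_ord x; have := ltn_ord y.
by move=> yn xn; case: (leqP x y) => xy cxy /orP[] /andP[_ /eqP]; lia.
Qed.

Variable R : realType.

Lemma brick_resist (h : 'I_n -> R) x y :
  (h x - h y) ^+ 2 <= 72 * 72 * ln n%:R / 2%:R * energy e h.
Proof.
have [r2 W0 hr wn] := brick_parameters.
have [Wn WN N8] := brick_width.
have n0 : (0 < n)%N by lia.
pose o i : 'I_n := insubd (Ordinal n0) i.
have oE i : (i < n)%N -> nat_of_ord (o i) = i.
  by move=> hi; rewrite /o val_insubd hi.
have oi i j : (i < n)%N -> (j < n)%N -> o i = o j -> i = j.
  by move=> hi hj /(congr1 (@nat_of_ord n)); rewrite !oE.
have on u : o (nat_of_ord u) = u by apply: val_inj; rewrite /= oE.
have eS i : (i.+1 < n)%N -> e (o i) (o i.+1).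
  move=> hi; rewrite /e /circulant /cdist /P !oE ?(ltnW hi) // leqnSn subSnn.
  by rewrite orTb.
have eS' i : (i.+1 < n)%N -> e (o i.+1) (o i) by move=> hi; rewrite brick_sym eS.
have eW i : (i.*2 + w < n)%N -> e (o i.*2) (o (i.*2 + w)%N).
  move=> hi; rewrite /e /chord !oE ?odd_double ?eqxx ?orbT //; lia.
set E := energy e h.
have E0 : 0 <= E by exact: energy_ge0.
pose N := n./2.
have hN : (N.*2 <= n <= N.*2.+1)%N.
  by rewrite /N; have := odd_double_half n; have := leq_b1 (odd n); lia.
pose a i := h (o i.*2).
(* A grid edge is a path of two edges through an odd vertex: [2 * t + 1] for shift [1], and
   [2 * t + w = 2 * (t + W) + 1] for shift [W]. *)
have e1 : shift_energy N a 1 <= 4 * E.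
  apply: (@two_edges_energy R n e h (N - 1) (fun t => o (t + 1).*2)
    (fun t => o t.*2.+1) (fun t => o t.*2)); first exact: brick_sym.
  - by move=> i j hi hj /oi H; have := H _ _; lia.
  - by move=> i j hi hj /oi H; have := H _ _; lia.
  - move=> i hi; rewrite addn1 doubleS eS' ?eS' //; lia.
have eW4 : shift_energy N a W <= 4 * E.
  apply: (@two_edges_energy R n e h (N - W) (fun t => o (t + W).*2)
    (fun t => o (t + W).*2.+1) (fun t => o t.*2)); first exact: brick_sym.
  - by move=> i j hi hj /oi H; have := H _ _; lia.
  - by move=> i j hi hj /oi H; have := H _ _; lia.
  - move=> i hi; rewrite eS; last lia.
    by rewrite brick_sym doubleD -addnS eW // /w; lia.
have nearest u : exists2 i, (i < N)%N & (h u - a i) ^+ 2 <= 4 * E.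
  have un := ltn_ord u; rewrite -(on u).
  have hu := odd_double_half u; have ob := leq_b1 (odd u).
  case: (ltnP u./2 N) => uN.
    exists u./2 => //; rewrite /a -{1}hu; case: (odd u) hu => hu.
      by rewrite add1n; apply: le_trans (edge_energy h (eS' _ _)) _; [lia|rewrite -/E; lra].
    by rewrite add0n subrr expr0n /=; lra.
  (* For odd [n] the last vertex [2 * N] is unpaired; it is two cycle edges away from
     [2 * (N - 1)]. *)
  exists N.-1; first by lia.
  have -> : nat_of_ord u = (N.-1).*2.+2 by lia.
  rewrite /a; set p := h _; set q := h _; set z := h (o (N.-1).*2.+1).
  have h1 : (p - z) ^+ 2 <= E by apply: edge_energy; apply: eS'; lia.
  have h2 : (z - q) ^+ 2 <= E by apply: edge_energy; apply: eS'; lia.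
  have := sqr_add_le2 (p - z) (z - q); have -> : p - z + (z - q) = p - q by ring.
  by move=> h3; lra.
have [i iN hi] := nearest x; have [j jN hj] := nearest y.
have hij : (a i - a j) ^+ 2 <=
    (12 * harmonic_sum R W + 3 * (N%:R / W%:R ^+ 2)) * 8 * E.
  apply: le_trans (grid_resist W0 a WN iN jN) _; rewrite -[X in _ <= X]mulrA.
  apply: ler_wpM2l; last by rewrite /grid_energy; lra.
  rewrite addr_ge0 // !mulr_ge0 // ?invr_ge0 ?exprn_ge0 //.
  by apply: sumr_ge0 => k _; rewrite invr_ge0.
have hj' : (a j - h y) ^+ 2 <= 4 * E by rewrite -sqrrN opprB.
have := sqr_add3_le hi hij hj'.
have -> : h x - a i + (a i - a j) + (a j - h y) = h x - h y by ring.
move=> H; apply: le_trans H _; apply: ler_wpM2r => //.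
have n2 : (2 <= n)%N by lia.
have lnh := ln_ge_half R n2.
have HW : harmonic_sum R W <= 1 + ln n%:R.
  apply: le_trans (harmonic_sum_le R W0) _; rewrite lerD2l ler_ln ?posrE ?ltr0n //.
  by rewrite ler_nat.
have NW : N%:R / W%:R ^+ 2 <= 8 :> R.
  by rewrite ler_pdivrMr ?exprn_gt0 ?ltr0n // -natrX -natrM ler_nat -mulnn.
(* The total [3 * (4 + 8 * (12 * (1 + L) + 24) + 4) = 888 + 288 * L] is at most [2064 * L], because
   [1 <= 2 * L], and [72 * 72 / 2 = 2592]. *)
move: lnh HW NW; set L := ln _; set H := harmonic_sum _ _; set z := _ / _ => lnh HW NW.
by lra.
Qed.

Lemma brick_graph : sparse_bound R n 2.
Proof.
have [r2 W0 hr wn] := brick_parameters.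
have n0 : (0 < n)%N by lia.
have n1 : (1 < n)%N by lia.
apply: (@sparse_boundI R n 2 r w e (Ordinal n1) (Ordinal n0)) => //.
- by lia.
- by rewrite /w; lia.
- exact: brick_sym.
- exact: brick_irr.
- move=> x; rewrite brick_degree degree_chord.
  by case: ifP => _; [case: (w <= x)%N | case: (x + w < n)%N].
- by rewrite brick_degree degree_chord /= /w; lia.
- by rewrite brick_degree degree_chord /=; lia.
- exact: brick_resist.
- move=> x y; have := ltn_ord x; have := ltn_ord y.
  rewrite /e /circulant /P /cdist /chord => yn xn /orP[].
    by case: (leqP x y); rewrite /w; lia.
  by move=> /orP[] /andP[_ /eqP]; lia.
Qed.

End Brickwork.

(** For [n = 4] the brickwork chord would have length [3] and coincide with a cycle edge; the
    4-cycle with one diagonal replaces it. *)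
Lemma four_vertices_graph (R : realType) : sparse_bound R 4 2.
Proof.
pose P : pred nat := fun z => (1 <= z < 2)%N || (3 <= z < 4)%N.
pose e : rel 'I_4 := fun x y => circulant P x y || link 0 2 x y.
have deg x : degree e x = (2 + ((nat_of_ord x == 0) + (nat_of_ord x == 2)))%N.
  rewrite degree_union ?degree_link // => [|y].
    by rewrite degree_circulant !big_ord_recl big_ord0.
  by case: x => [[|[|[|[|]]]] ?] //; case: y => [[|[|[|[|]]]] ?].
have esym : symmetric e.
  move=> x y; rewrite /e link_sym circulant_sym //.
  by move=> [|[|[|[|]]]].
have l1 : (0 < 1)%N by [].
have l4 : (1 <= 4)%N by [].
have band (x y : 'I_4) : x != y -> (y <= x + (2 * 1).-1)%N ->
    (x <= y + (2 * 1).-1)%N -> e x y.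
  by case: x => [[|[|[|[|]]]] ?] //; case: y => [[|[|[|[|]]]] ?].
apply: (@sparse_boundI R 4 2 2 2 e (Ordinal (isT : 1 < 4)%N) (Ordinal (isT : 0 < 4)%N)) => //.
- by case=> [[|[|[|[|]]]] ?].
- by move=> x; rewrite deg; case: x => [[|[|[|[|]]]] ?].
- move=> h x y; apply: le_trans (band_resist h l1 l4 band x y) _.
  apply: ler_wpM2r; first exact: energy_ge0.
  by have := ln_ge_half R (isT : 2 <= 4)%N; rewrite expr1n !invr1; set L := ln _; lra.
- by case=> [[|[|[|[|]]]] ?] //; case=> [[|[|[|[|]]]] ?].
Qed.

(* A d-regular graph on n vertices exists only if n * d is even.  The value
   d = 1 is excluded from the second part: the only connected graph with
   minimum degree 1 and maximum degree 2 is the path, whose ratio is at least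
   (n-1) / 2. *)
Theorem theorem4p15 (R : realType) :
  (exists C : R, 0 < C /\
     forall n d : nat,
       Num.sqrt (n%:R : R) <= d%:R -> (d < n)%N -> ~~ odd (n * d) ->
       exists e : rel 'I_n,
         [/\ simple_connected_graph e, regular e d &
             (cover_broadcast_ratio R e <= (C * (d%:R * ln n%:R))%:E)%E])
  /\
  (exists C : R, 0 < C /\
     forall n d : nat,
       (2 <= d)%N -> d%:R <= Num.sqrt (n%:R : R) ->
       exists e : rel 'I_n,
         [/\ simple_connected_graph e, min_degree e d, max_degree e d.+1 &
             (cover_broadcast_ratio R e
               <= (C * (Num.sqrt n%:R * ln n%:R ^+ 2))%:E)%E]).
Proof.
split.
  exists ((4 * (81 * 5) + 1) * 32); split; first by lra.
  move=> n d nd dn par; apply: dense_graph => //.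
  have : Num.sqrt (n%:R : R) ^+ 2 <= d%:R ^+ 2.
    by rewrite lerXn2r ?nnegrE ?sqrtr_ge0.
  by rewrite sqr_sqrtr // -natrX ler_nat mulnn.
exists ((6 * (72 * 72) + 2) * 48); split; first by lra.
move=> n d d2 dn; have {}dn : (d * d <= n)%N.
  have : (d%:R : R) ^+ 2 <= Num.sqrt n%:R ^+ 2.
    by rewrite lerXn2r ?nnegrE ?sqrtr_ge0.
  by rewrite sqr_sqrtr // -natrX ler_nat mulnn.
have [r /andP[rn nr]] := exists_nat_sqrt n.
case: (ltnP 2 d) => d3.
  by apply: (@sparse_graph n d r) => //; nia.
have -> : d = 2%N by lia.
have [->|n4] := eqVneq n 4%N; first exact: four_vertices_graph.
by apply: (@brick_graph n r) => //; nia.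
Qed.
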